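(* Suppose that $\lambda\in[0,1]$. Then there is a transcendental entire function $f$ with a wandering domain $U$ and a bounded domain $D\subset\mathbb{C}$ such that $$\lim_{k\rightarrow\infty}\frac{\#\{n\in\mathbb{N} : n\leq k,\ f^n(U)\subset D\}}{k}=\lambda.$$
   Context: Here $\mathbb{N}=\{1,2,3,\dots\}$ and $\#$ denotes cardinality. A domain is a non-empty open connected subset of $\mathbb{C}$. For an entire function $f$, $f^n$ denotes the $n$-th iterate of $f$ ($n\ge 0$). The Fatou set $F(f)$ is the set of points $z\in\mathbb{C}$ having a neighbourhood on which the iterates $\{f^n\}_{n\in\mathbb{N}}$ form a normal family (in the usual sense of complex dynamics: every sequence of iterates has a subsequence converging locally uniformly to a holomorphic function or to $\infty$). A wandering domain of $f$ is a connected component $U$ of $F(f)$ such that, for $n,m\ge 0$, $f^n(U)\cap f^m(U)\neq\emptyset$ only when $n=m$. A transcendental entire function is an entire function that is not a polynomial. *)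

(* Defs.v *)
From HB Require Import structures.
From mathcomp Require Import all_boot all_order all_algebra.
From mathcomp Require Import all_classical all_reals all_analysis.
From mathcomp Require Export complex.

Set Implicit Arguments.
Unset Strict Implicit.
Unset Printing Implicit Defensive.

Import Order.TTheory GRing.Theory Num.Theory.
Import numFieldNormedType.Exports.

Local Open Scope classical_set_scope.
Local Open Scope ring_scope.
Local Open Scope complex_scope.

(* The library puts the topology and norm of a field on its regular module
   R[i]^o; these instances carry them over to R[i] itself. *)
HB.instance Definition _ (R : realType) := NormedModule.copy R[i] R[i]^o.

Section ComplexDynamics.
Variable R : realType.
Local Notation C := R[i].
Implicit Types (f g : C -> C) (u : nat -> C -> C) (U V D : set C).

(* [derivable _ z 1] over the field C is complex differentiability at z. *)
Definition holomorphic_on V g := forall z, V z -> derivable g z 1.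

Definition entire f := holomorphic_on setT f.

Definition transcendental_entire f :=
  entire f /\ ~ exists p : {poly C}, forall z, f z = p.[z].

Definition locally_uniform_cvg V u g :=
  forall z, V z -> exists2 W, nbhs z W & {uniform W, u @ \oo --> g}.

Definition locally_uniform_cvg_infty V u :=
  forall z, V z -> exists2 W, nbhs z W &
    forall M : R, \forall n \near \oo, forall w, W w -> M%:C < `|u n w|.

(* The limit g is only meaningful on V, its values elsewhere are irrelevant. *)
Definition normal_family V (F : set (C -> C)) :=
  forall u, (forall k, F (u k)) ->
  exists2 s : nat -> nat, {homo s : m n / (m < n)%N} &
    (exists2 g, holomorphic_on V g & locally_uniform_cvg V (u \o s) g) \/
    locally_uniform_cvg_infty V (u \o s).

Definition iterates f : set (C -> C) :=
  [set h | exists2 n, (0 < n)%N & h = iter n f].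

Definition Fatou f : set C :=
  [set z | exists V, [/\ open V, V z & normal_family V (iterates f)]].

Definition Fatou_component f U :=
  exists2 z, Fatou f z & U = connected_component (Fatou f) z.

Definition wandering_domain f U :=
  Fatou_component f U /\
  forall n m, (iter n f @` U) `&` (iter m f @` U) !=set0 -> n = m.

Definition domain D := [/\ D !=set0, open D & connected D].

(* ['I_k.+1] bounds n by k; n = 0 is excluded since times start at 1. *)
Definition visits f U D (k : nat) : nat :=
  #|[set n : 'I_k.+1 | (0 < n)%N && `[< iter n f @` U `<=` D >]]|.

End ComplexDynamics.

(* Main.v *)
(* [f] is the limit of real polynomials, each obtained from the previous one by
   a correction that is tiny on a large disc, subject to three constraints.
   - On the circle of radius [Rad k], [`|f| >= Rad k.+1]. If [f^n(U)] met both
     sides of the first circle, then [f^(n+k)(K)] would reach the [k]-th circle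
     for all [k] and some connected [K], whereas normality bounds [f^(n+k)] on
     [K] along the times at which the orbit is back near 0. So [f^n(U)] lies in
     the disc of radius [Rad 0] whenever the orbit is near 0 at time [n].
   - On the unit disc around [cen k], [f] is nearly affine and its image covers
     the unit disc around [cen k.+1] (also the unit disc itself if [k = 0]), so
     real orbits with prescribed itineraries exist by the intermediate value
     theorem.
   - On the unit disc around [cen k.+1 + 10], the [k]-th hole, [f] is nearly
     constant, equal to a real number whose orbit stays near 0 as long as we
     like, then climbs one level per step and enters the next hole.
   The forward images of the first hole shrink, so it lies in the Fatou set by
   Bolzano-Weierstrass alone. Its component wanders since, for each [p >= 1], the
   orbit has arbitrarily high points whose [p]-th successors are bounded. The
   climb after the [k]-th hole takes about [k] steps, and the waiting times near
   0 are chosen to give the required frequency. *)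
Require Import Defs.
From mathcomp Require Import all_boot all_order all_algebra.
From mathcomp Require Import all_classical all_reals all_analysis.
From mathcomp Require Import complex.
From mathcomp Require Import ring lra zify.
Set Implicit Arguments.
Unset Strict Implicit.
Unset Printing Implicit Defensive.
Import Order.TTheory GRing.Theory Num.Theory.
Import numFieldNormedType.Exports.
Import ComplexField.Normc.
Local Open Scope classical_set_scope.
Local Open Scope ring_scope.

(** * The complex norm, derivatives and segments in epsilon-delta form *)

Section ComplexNorm.
Variable R : realType.
Local Notation C := (R[i]).
Implicit Types (z w : C) (A : set C).

Lemma normc_ge0 z : 0 <= normc z.
Proof. by case: z => a b; exact: sqrtr_ge0. Qed.
Lemma normcD z w : normc (z + w) <= normc z + normc w.
Proof. exact: (@le_normcD R z w). Qed.
Lemma normcB_sym z w : normc (z - w) = normc (w - z).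
Proof. by rewrite -(@normcN R (z - w)) opprB. Qed.
Lemma normc_real (x : R) : normc x%:C%C = `|x|.
Proof. by rewrite /normc /= expr0n /= addr0 sqrtr_sqr. Qed.

Lemma ball_normc z w (e : R) : ball_ Num.norm z e%:C%C w <-> normc (w - z) < e.
Proof. by rewrite /ball_ /= normcB_sym -ltcR. Qed.

(** The norm of [R[i]] takes values in [R[i]]; its radii are traded here for real ones, so that all
    later estimates live in [R]. *)
Lemma nbhs_normcP z A :
  nbhs z A <-> exists2 e : R, 0 < e & forall w, normc (w - z) < e -> A w.
Proof.
split.
  move=> /nbhs_normP [e /= e0 eA].
  have er : e = (complex.Re e)%:C%C by rewrite RRe_real // gtr0_real.
  exists (complex.Re e); first by rewrite -ltcR -er.
  by move=> w /ball_normc; rewrite -er => h; exact: eA.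
case=> e e0 eA; apply/nbhs_normP; exists e%:C%C; first by rewrite /= ltcR.
by move=> w /ball_normc; exact: eA.
Qed.

Lemma uniform_cvgP (W : set C) (u : nat -> C -> C) (g : C -> C) :
  {uniform W, u @ \oo --> g} <-> forall e : R, 0 < e ->
   exists N, forall n, (N <= n)%N -> forall w, W w -> normc (u n w - g w) < e.
Proof.
split.
  move=> ug e e0.
  have [|N _ hN] := ug [set h | forall y, W y -> ball_ Num.norm (g y) e%:C%C (h y)].
    apply/uniform_nbhs; exists [set p | ball_ Num.norm p.1 e%:C%C p.2]; split => //.
    rewrite -entourage_ballE; exists e%:C%C; first by rewrite /= ltcR.
    by move=> [x y].
  by exists N => n Nn w Ww; apply/ball_normc; exact: hN.
move=> ug P /uniform_nbhs [E [+ EP]].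
rewrite -entourage_ballE => -[e /= e0 eE].
have er : e = (complex.Re e)%:C%C by rewrite RRe_real // gtr0_real.
have e1 : 0 < complex.Re e by rewrite -ltcR -er.
have [N hN] := ug _ e1.
exists N => // n /= Nn; apply: EP => /= y Wy; apply: eE => /=.
by move/ball_normc: (hN _ Nn _ Wy); rewrite -er.
Qed.

Lemma normc_gt0 z : z != 0 -> 0 < normc z.
Proof.
by move=> z0; rewrite lt_def normc_ge0 andbT; apply: contra z0 => /eqP/eq0_normc ->.
Qed.

(** The remainder form avoids the difference quotient, which suits compositions and the passage to
    the limit over polynomials. *)
Lemma derivable_normcP (f : C -> C) z : derivable f z 1 <->
  exists L : C, forall e : R, 0 < e -> exists2 d : R, 0 < d &
    forall w, normc (w - z) < d ->
      normc (f w - f z - L * (w - z)) <= e * normc (w - z).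
Proof.
split.
  move=> /cvg_ex [L fL]; exists L => e e0.
  have /nbhs_normcP [d d0 hd] := fL _ (proj2 (nbhs_normcP _ [set u | normc (u - L) < e])
     (ex_intro2 _ _ e e0 (fun _ h => h))).
  exists d => // w wd.
  have [->|wz] := eqVneq w z; first by rewrite !subrr mulr0 subr0 normc0 mulr0.
  have wz0 : w - z != 0 by rewrite subr_eq0.
  have := hd (w - z); rewrite subr0 => /(_ wd wz0) /=.
  rewrite /GRing.scale /= mulr1 subrK => h.
  have -> : f w - f z - L * (w - z) = ((w - z)^-1 * (f w - f z) - L) * (w - z).
    by rewrite mulrBl mulrAC mulVf // mul1r.
  by rewrite normcM ler_wpM2r ?normc_ge0 // ltW.
move=> [L hL]; apply/cvg_ex; exists L => A /nbhs_normcP [e e0 eA].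
have [|d d0 hd] := hL (e / 2); first by rewrite divr_gt0.
apply/nbhs_normcP; exists d => // h; rewrite subr0 => hd' h0; apply: eA => /=.
rewrite /GRing.scale /= mulr1.
have := hd (h + z); rewrite addrK => /(_ hd') {}hd.
have -> : h^-1 * (f (h + z) - f z) - L = h^-1 * (f (h + z) - f z - L * h).
  by rewrite [RHS]mulrBr [L * h]mulrC mulKf.
rewrite normcM normcV mulrC ltr_pdivrMr ?normc_gt0 //.
by apply: le_lt_trans hd _; rewrite ltr_pM2r ?normc_gt0 // ltr_pdivrMr // ltr_pMr // ltr1n.
Qed.

Lemma derivable_normc_continuous (f : C -> C) z : derivable f z 1 ->
  forall e : R, 0 < e -> exists2 d : R, 0 < d &
    forall w, normc (w - z) < d -> normc (f w - f z) < e.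
Proof.
move=> /derivable_normcP [L hL] e e0.
have [d d0 hd] := hL 1 ltr01.
have k0 : 0 < 1 + normc L by rewrite ltr_pwDl ?normc_ge0.
exists (Num.min d (e / (1 + normc L))); first by rewrite lt_min d0 divr_gt0.
move=> w; rewrite lt_min => /andP[wd we].
rewrite -[f w - f z](subrK (L * (w - z))).
apply: le_lt_trans (normcD _ _) _; rewrite normcM.
apply: (@le_lt_trans _ _ ((1 + normc L) * normc (w - z))); last first.
  by rewrite mulrC -ltr_pdivlMr.
by rewrite mulrDl lerD2r; exact: hd.
Qed.

Lemma derivable_compC (f g : C -> C) z :
  derivable g z 1 -> derivable f (g z) 1 -> derivable (f \o g) z 1.
Proof.
move=> dg; have cg := derivable_normc_continuous dg.
move: dg => /derivable_normcP [M hM] /derivable_normcP [L hL].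
apply/derivable_normcP; exists (L * M) => e e0.
pose k := normc L + normc M + 1.
have k0 : 0 < k by rewrite ltr_wpDl // addr_ge0 ?normc_ge0.
(* The remainder will be [a + L * b], bounded by [e1 * k * normc (w - z)]; the cap 1 bounds the
   difference quotients of [g] by [1 + normc M]. *)
pose e1 := Num.min 1 (e / (2 * k)).
have e10 : 0 < e1 by rewrite lt_min ltr01 divr_gt0 ?mulr_gt0.
have [d1 d10 h1] := hL _ e10.
have [d2 d20 h2] := hM _ e10.
have [d3 d30 h3] := cg _ d10.
exists (Num.min d2 d3); first by rewrite lt_min d20.
move=> w; rewrite lt_min => /andP[wd2 wd3] /=.
have H1 := h1 _ (h3 _ wd3); have H2 := h2 _ wd2.
set a := f (g w) - _ - _ in H1; set b := g w - g z - _ in H2.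
have -> : f (g w) - f (g z) - L * M * (w - z) = a + L * b by rewrite /a /b; ring.
apply: le_trans (normcD _ _) _; rewrite normcM.
have gw : normc (g w - g z) <= (1 + normc M) * normc (w - z).
  have -> : g w - g z = b + M * (w - z) by rewrite /b; ring.
  apply: le_trans (normcD _ _) _; rewrite normcM mulrDl lerD2r.
  by apply: le_trans H2 _; rewrite ler_wpM2r ?normc_ge0 // ge_min lexx.
have n0 := normc_ge0 (w - z); have L0 := normc_ge0 L; have M0 := normc_ge0 M.
have A1 : normc a <= e1 * ((1 + normc M) * normc (w - z)).
  by apply: le_trans H1 _; rewrite ler_wpM2l // ltW.
have A2 : normc L * normc b <= normc L * (e1 * normc (w - z)) by rewrite ler_wpM2l.
have A3 : e1 * k <= e.
  have : e1 <= e / (2 * k) by rewrite ge_min lexx orbT.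
  move=> /(ler_wpM2r (ltW k0)) /le_trans; apply.
  have -> : e / (2 * k) * k = e / 2 by field; lra.
  lra.
apply: le_trans (lerD A1 A2) _.
have -> : e1 * ((1 + normc M) * normc (w - z)) + normc L * (e1 * normc (w - z))
  = (e1 * k) * normc (w - z) by rewrite /k; ring.
by rewrite ler_wpM2r.
Qed.

(** Witnessed by the segment; the last clause is the convexity of every open disc that contains both
    ends. *)
Lemma segment_connectedC z w :
  exists K : set C, [/\ connected K, K z, K w &
    forall u c (r : R), K u -> normc (z - c) < r -> normc (w - c) < r -> normc (u - c) < r].
Proof.
exists ((fun t : R => z + t%:C%C * (w - z)) @` `[0, 1]); split.
- apply: connected_continuous_connected; first exact: segment_connected.
  apply: continuous_subspaceT => t A /nbhs_normcP [e e0 eA].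
  pose k := 1 + normc (w - z).
  have k0 : 0 < k by rewrite ltr_pwDl ?normc_ge0.
  apply/nbhs_normP; exists (e / k); first by rewrite /= divr_gt0.
  move=> s; rewrite /ball_ /= ltr_pdivlMr // => hs; apply: eA.
  have -> : z + s%:C%C * (w - z) - (z + t%:C%C * (w - z)) = (s - t)%:C%C * (w - z).
    by rewrite rmorphB /=; ring.
  rewrite normcM normc_real distrC; apply: le_lt_trans hs.
  by rewrite ler_wpM2l // lerDr.
- by exists 0; rewrite ?rmorph0 ?mul0r ?addr0 //= in_itv /= lexx ler01.
- by exists 1; rewrite ?rmorph1 ?mul1r ?(addrC z) ?subrK //= in_itv /= lexx ler01.
move=> _ c r [t + <-]; rewrite /= in_itv /= => /andP[t0 t1] zc wc.
have -> : z + t%:C%C * (w - z) - c = (1 - t)%:C%C * (z - c) + t%:C%C * (w - c).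
  by rewrite rmorphB rmorph1; ring.
apply: le_lt_trans (normcD _ _) _; rewrite !normcM !normc_real !ger0_norm ?subr_ge0 //.
have [t00|tn0] := eqVneq t 0; first by rewrite t00; lra.
have tp : 0 < t by rewrite lt_def tn0.
have : t * normc (w - c) < t * r by rewrite ltr_pM2l.
have : (1 - t) * normc (z - c) <= (1 - t) * r by rewrite ler_wpM2l ?subr_ge0 // ltW.
lra.
Qed.
End ComplexNorm.

(** * Bounded orbits along a Fatou component *)

Section FatouTopology.
Variable R : realType.
Local Notation C := (R[i]).
Variable f : C -> C.
Hypothesis f_entire : entire f.

Lemma iter_derivable n z : derivable (iter n f) z 1.
Proof.
elim: n z => [|n IH] z; first exact: derivable_id.
exact: (derivable_compC (IH z) (@f_entire _ I)).
Qed.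

(** Otherwise some points tending to [z] have images of modulus above [i] under members [u k_i]. A
    subsequence of these members can neither converge to a holomorphic limit, which is bounded near
    [z], nor tend to infinity, being bounded at [z]. *)
Lemma Fatou_locally_bounded z (u : nat -> C -> C) (M : R) :
  Fatou f z -> (forall k, iterates f (u k)) -> (forall k, normc (u k z) <= M) ->
  exists2 d : R, 0 < d &
    exists M' : R, forall k w, normc (w - z) < d -> normc (u k w) <= M'.
Proof.
move=> [V [Vo Vz nV]] uf uM; apply: contrapT => nb.
have /choice [kw hkw] : forall i : nat, exists kw : nat * C,
    normc (kw.2 - z) < i.+1%:R^-1 /\ i%:R < normc (u kw.1 kw.2).
  move=> i; apply: contrapT => h; apply: nb.
  exists i.+1%:R^-1; first by rewrite invr_gt0.
  exists i%:R => k w wz; rewrite leNgt; apply/negP => uw.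
  by apply: h; exists (k, w).
have [|s s_homo [[g gh ug]|uoo]] := nV (fun i => u (kw i).1).
- by move=> i; exact: uf.
- have [W /nbhs_normcP [d1 d10 dW] /uniform_cvgP ugW] := ug _ Vz.
  have [N hN] := ugW _ ltr01.
  have [d2 d20 hg] := derivable_normc_continuous (gh _ Vz) ltr01.
  have [n1 hn1] : exists n1 : nat, (normc (g z) + 2 < n1%:R) /\ 1 / Num.min d1 d2 < n1%:R.
    pose x := Num.max (normc (g z) + 2) (1 / Num.min d1 d2).
    exists (Num.bound x); have : x < (Num.bound x)%:R.
      by apply: archi_boundP; rewrite le_max addr_ge0 // normc_ge0.
    by rewrite /x gt_max => /andP[].
  pose n := maxn N n1.
  have sn : (n <= s n)%N.
    elim: {1 2}n => // m IH; exact: leq_ltn_trans IH (s_homo _ _ (ltnSn m)).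
  have [h1 h2] := hkw (s n).
  have wn : normc ((kw (s n)).2 - z) < Num.min d1 d2.
    apply: lt_trans h1 _; rewrite invf_plt ?posrE ?lt_min ?d10 ?d20 //.
    rewrite -div1r; apply: lt_le_trans (proj2 hn1) _.
    by rewrite ler_nat (leq_trans (leq_maxr N n1)) // (leq_trans sn).
  move: wn; rewrite lt_min => /andP[/dW wW /hg wg].
  have := hN _ (leq_maxl N n1) _ wW; rewrite /= => wu.
  have : (s n)%:R < normc (g z) + 2.
    apply: lt_trans h2 _; rewrite -/n in wu.
    have -> : u (kw (s n)).1 (kw (s n)).2 =
      (u (kw (s n)).1 (kw (s n)).2 - g (kw (s n)).2) + (g (kw (s n)).2 - g z) + g z by ring.
    apply: le_lt_trans (normcD _ _) _.
    have := normcD (u (kw (s n)).1 (kw (s n)).2 - g (kw (s n)).2) (g (kw (s n)).2 - g z).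
    lra.
  apply/negP; rewrite -leNgt; apply: le_trans (ltW (proj1 hn1)) _.
  by rewrite ler_nat (leq_trans (leq_maxr N n1)).
have [W Wz hW] := uoo _ Vz.
have [N _ hN] := hW M.
have := hN N (leqnn N) z (nbhs_singleton Wz).
by rewrite ltcR ltNge uM.
Qed.

(** A subsequence that is unbounded at [z] has no finite limit there, so normality makes it tend to
    infinity on a whole neighbourhood. *)
Lemma Fatou_locally_unbounded z (u : nat -> C -> C) :
  Fatou f z -> (forall k, iterates f (u k)) ->
  (forall M : R, exists k, M < normc (u k z)) ->
  exists2 d : R, 0 < d & forall w, normc (w - z) < d ->
    forall M : R, exists k, M < normc (u k w).
Proof.
move=> [V [Vo Vz nV]] uf uM.
have /choice [kz hkz] : forall i : nat, exists k, i%:R < normc (u k z) by move=> i; exact: uM.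
have [|s s_homo [[g gh ug]|uoo]] := nV (fun i => u (kz i)).
- by move=> i; exact: uf.
- have [W Wz /uniform_cvgP ugW] := ug _ Vz.
  have [N hN] := ugW _ ltr01.
  pose n := maxn N (Num.bound (normc (g z) + 1)).
  have sn : (n <= s n)%N.
    elim: {1 2}n => // m IH; exact: leq_ltn_trans IH (s_homo _ _ (ltnSn m)).
  have := hN n (leq_maxl _ _) z (nbhs_singleton Wz); rewrite /= => un.
  have := hkz (s n).
  have : normc (g z) + 1 < n%:R.
    apply: (@lt_le_trans _ _ (Num.bound (normc (g z) + 1))%:R).
      by apply: archi_boundP; rewrite addr_ge0 ?normc_ge0.
    by rewrite ler_nat leq_maxr.
  have : (n%:R : R) <= (s n)%:R by rewrite ler_nat.
  have := normcD (u (kz (s n)) z - g z) (g z); rewrite subrK.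
  lra.
have /nbhs_normcP [d d0 dV] : nbhs z V by exact: open_nbhs_nbhs.
exists d => // w /dV Vw M; have [W Ww hW] := uoo _ Vw.
have [N _ hN] := hW M; exists (kz (s N)).
by have := hN N (leqnn N) w (nbhs_singleton Ww); rewrite ltcR.
Qed.

(* The points reachable from [z] inside a connected set on which [u] is
   uniformly bounded are clopen in the Fatou set: near a Fatou point, [u] is
   either uniformly bounded or unbounded at every point. *)
Lemma Fatou_component_bounded a z w (u : nat -> C -> C) (M : R) :
  connected_component (Fatou f) a z -> connected_component (Fatou f) a w ->
  (forall k, iterates f (u k)) -> (forall k, normc (u k z) <= M) ->
  exists K : set C, [/\ connected K, K z, K w &
    exists M' : R, forall k x, K x -> normc (u k x) <= M'].
Proof.
set U := connected_component _ _ => Uz Uw uf uM.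
pose T := [set x | exists K : set C, [/\ connected K, K z, K x &
    exists M' : R, forall k x, K x -> normc (u k x) <= M']].
have UF : U `<=` Fatou f by exact: connected_component_sub.
(* On a disc where [u] is uniformly bounded, membership in [T] passes from point to point by
   attaching a segment to [K]. *)
have spread x (d : R) M1 :
    (forall k y, normc (y - x) < d -> normc (u k y) <= M1) ->
    forall y y', normc (y - x) < d -> normc (y' - x) < d -> T y -> T y'.
  move=> hx y y' yx y'x [K [Kc Kz Ky [M2 hM2]]].
  have [S [Sc Sy Sy' Sball]] := segment_connectedC y y'.
  exists (K `|` S); split; [|by left|by right|].
    by apply: connectedU => //; exists y.
  exists (Num.max M1 M2) => k v [Kv|Sv]; rewrite le_max; apply/orP.
    by right; exact: hM2.
  by left; apply: hx; exact: Sball Sv _ _.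
have Tpt x : T x -> exists M1, forall k, normc (u k x) <= M1.
  by move=> [K [_ _ Kx [M1 hM1]]]; exists M1 => k; exact: hM1.
have Topen x : U x -> T x -> nbhs x T.
  move=> Ux Tx; have [M1 hM1] := Tpt _ Tx.
  have [d d0 [M2 hM2]] := Fatou_locally_bounded (UF _ Ux) uf hM1.
  apply/nbhs_normcP; exists d => // y yx.
  by apply: (spread _ _ _ hM2 x) => //; rewrite subrr normc0.
have Tclosed x : U x -> ~ T x -> nbhs x (~` T).
  move=> Ux nTx; have [[M1 hM1]|unb] := pselect (exists M1, forall k, normc (u k x) <= M1).
    have [d d0 [M2 hM2]] := Fatou_locally_bounded (UF _ Ux) uf hM1.
    apply/nbhs_normcP; exists d => // y yx Ty; apply: nTx.
    by apply: (spread _ _ _ hM2 y) => //; rewrite subrr normc0.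
  have [|d d0 hd] := Fatou_locally_unbounded (UF _ Ux) uf.
    move=> M1; apply: contrapT => h; apply: unb; exists M1 => k.
    by rewrite leNgt; apply/negP => h1; apply: h; exists k.
  apply/nbhs_normcP; exists d => // y /hd yun Ty.
  have [M1 hM1] := Tpt _ Ty; have [k] := yun M1.
  by rewrite ltNge hM1.
have UT : U `&` T = U.
  apply: component_connected.
  - exists z; split => //; exists [set z]; split => //; first exact: connected1.
    by exists M => k x ->; exact: uM.
  - exists (interior T); first exact: open_interior.
    apply/seteqP; split => x [Ux Tx]; split => //; first exact: Topen.
    exact: interior_subset Tx.
  exists (~` interior (~` T)); first exact/open_closedC/open_interior.
  apply/seteqP; split => x [Ux Tx]; split => //.
    by move=> /interior_subset.
  by apply: contrapT => nT; apply: Tx; exact: Tclosed.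
by have [_ Tw] : (U `&` T) w by rewrite UT.
Qed.

End FatouTopology.

(** * Subsequences and cluster points *)

Lemma subseq_exists (P : nat -> nat -> Prop) :
  (forall i N, exists2 k, (N <= k)%N & P i k) ->
  exists2 s : nat -> nat, {homo s : m n / (m < n)%N} & forall i, P i (s i).
Proof.
move=> h; have /choice [g hg] : forall iN : nat * nat, exists k, (iN.2 <= k)%N /\ P iN.1 k.
  by move=> [i N]; have [k ? ?] := h i N; exists k.
pose s := fix s i := if i is i'.+1 then g (i, (s i').+1) else g (0%N, 0%N).
exists s; last first.
  by case=> [|i]; [case: (hg (0%N, 0%N))|case: (hg (i.+1, (s i).+1))].
apply: (homo_ltn ltn_trans) => i.
by case: (hg (i.+1, (s i).+1)).
Qed.

Lemma homo_ltn_geid (s : nat -> nat) : {homo s : m n / (m < n)%N} -> forall n, (n <= s n)%N.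
Proof. by move=> hs; elim=> // n IH; exact: leq_ltn_trans IH (hs _ _ (ltnSn n)). Qed.

Section BolzanoWeierstrass.
Variable R : realType.

Lemma real_cluster_point (x : nat -> R) (M : R) : (forall k, `|x k| <= M) ->
  exists c, forall e, 0 < e -> forall N, exists2 k, (N <= k)%N & `|x k - c| < e.
Proof.
move=> xM; have [|c [_ hc]] := @segment_compact R (- M) M (x @ \oo) (fmap_proper_filter x _).
  by exists 0%N => // k _; rewrite /= in_itv /= -ler_norml.
exists c => e e0 N.
have [_ [[k Nk <-] /=]] := hc (x @` [set k | (N <= k)%N]) (ball c e)
  (ex_intro2 _ _ N I (fun k Nk => ex_intro2 _ _ k Nk erefl)) (nbhsx_ballx c e e0).
by rewrite -ball_normE /= distrC; exists k.
Qed.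

Lemma normc_geRe (z : R[i]) : `|complex.Re z| <= normc z.
Proof. by have := normc_ge_Re z; rewrite lecR. Qed.
Lemma normc_geIm (z : R[i]) : `|complex.Im z| <= normc z.
Proof.
by case: z => a b /=; rewrite -sqrtr_sqr ler_wsqrtr // lerDr sqr_ge0.
Qed.
Lemma normc_leReIm (z : R[i]) : normc z <= `|complex.Re z| + `|complex.Im z|.
Proof.
case: z => a b /=; have h : 0 <= `|a| + `|b| by rewrite addr_ge0.
rewrite -(ger0_norm h) -[leRHS]sqrtr_sqr ler_wsqrtr // sqrrD !real_normK ?num_real //.
by rewrite lerD2r lerDl mulrn_wge0 // mulr_ge0.
Qed.

Lemma complex_cluster_point (x : nat -> R[i]) (M : R) : (forall k, normc (x k) <= M) ->
  exists c, forall e : R, 0 < e -> forall N, exists2 k, (N <= k)%N & normc (x k - c) < e.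
Proof.
move=> xM.
have [c1 h1] : exists c, forall e, 0 < e -> forall N,
    exists2 k, (N <= k)%N & `|complex.Re (x k) - c| < e.
  by apply: (@real_cluster_point _ M) => k; exact: le_trans (normc_geRe _) (xM k).
have [|s s_homo hs] := @subseq_exists (fun i k => `|complex.Re (x k) - c1| < i.+1%:R^-1).
  by move=> i N; apply: h1; rewrite invr_gt0.
have [c2 h2] : exists c, forall e, 0 < e -> forall N,
    exists2 k, (N <= k)%N & `|complex.Im (x (s k)) - c| < e.
  by apply: (@real_cluster_point _ M) => k; exact: le_trans (normc_geIm _) (xM _).
exists (c1 +i* c2)%C => e e0 N.
have e20 : 0 < e / 2 by rewrite divr_gt0.
have [k Nk hk] := h2 _ e20 (maxn N (Num.bound (e / 2)^-1)).
exists (s k).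
  apply: leq_trans (homo_ltn_geid s_homo k).
  by apply: leq_trans Nk; exact: leq_maxl.
apply: le_lt_trans (normc_leReIm _) _.
have -> : complex.Re (x (s k) - (c1 +i* c2)%C) = complex.Re (x (s k)) - c1 by case: (x (s k)).
have -> : complex.Im (x (s k) - (c1 +i* c2)%C) = complex.Im (x (s k)) - c2 by case: (x (s k)).
rewrite [e]splitr ltrD //; apply: lt_trans (hs k) _.
rewrite invf_plt ?posrE //; apply: (@lt_le_trans _ _ (Num.bound (e / 2)^-1)%:R).
  by apply: archi_boundP; rewrite invr_ge0 ltW.
by rewrite ler_nat; apply: leq_trans (leqnSn k); apply: leq_trans Nk; exact: leq_maxr.
Qed.
End BolzanoWeierstrass.

(** * The Fatou component of an oscillating orbit *)

Section OscillatingOrbit.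
Variable R : realType.
Local Notation C := (R[i]).
Variables (f : C -> C) (a : C) (d : R).
Hypothesis f_entire : entire f.
Hypothesis d_gt0 : 0 < d.
Hypothesis contract : forall e : R, 0 < e -> exists N, forall n, (N <= n)%N ->
  forall w, normc (w - a) < d -> normc (iter n f w - iter n f a) < e.

(** For a sequence of iterates there are three cases. If an exponent recurs for ever, a constant
    subsequence works. Otherwise the exponents tend to infinity, and the contraction carries what
    happens at [a] to the whole disc: a constant limit if the orbit of [a] is bounded along a
    subsequence, and infinity if not. *)
Lemma contracting_Fatou : Fatou f a.
Proof.
exists [set w | normc (w - a) < d]; split.
- move=> w /= wd; apply/nbhs_normcP; exists (d - normc (w - a)); first by rewrite subr_gt0.
  move=> v vw /=; have -> : v - a = (v - w) + (w - a) by ring.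
  by apply: le_lt_trans (normcD _ _) _; rewrite -ltrBrDr.
- by rewrite /= subrr normc0.
move=> u uf; have /choice [n hn] : forall k, exists n, u k = iter n f.
  by move=> k; have [n _ ->] := uf k; exists n.
have open_nbhs z : normc (z - a) < d -> nbhs z [set w | normc (w - a) < d].
  move=> zd; apply/nbhs_normcP; exists (d - normc (z - a)); first by rewrite subr_gt0.
  move=> v vw /=; have -> : v - a = (v - z) + (z - a) by ring.
  by apply: le_lt_trans (normcD _ _) _; rewrite -ltrBrDr.
have [[m hm]|nm] := pselect (exists m, forall N, exists2 k, (N <= k)%N & n k = m).
  have [s s_homo hs] := @subseq_exists (fun _ k => n k = m) (fun _ => hm).
  exists s => //; left; exists (iter m f).
    by move=> z _; exact: iter_derivable.
  move=> z zd; exists [set w | normc (w - a) < d]; first exact: open_nbhs.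
  apply/uniform_cvgP => e e0; exists 0%N => k _ w _ /=.
  by rewrite hn hs subrr normc0.
have n_oo m : exists N, forall k, (N <= k)%N -> (m <= n k)%N.
  elim: m => [|m [N hN]]; first by exists 0%N.
  have [N' hN'] : exists N', forall k, (N' <= k)%N -> n k <> m.
    apply: contrapT => h; apply: nm; exists m => N'; apply: contrapT => h'.
    by apply: h; exists N' => k Nk nk; apply: h'; exists k.
  exists (maxn N N') => k; rewrite geq_max => /andP[/hN h1 /hN' /eqP h2].
  by rewrite ltn_neqAle eq_sym h2.
have [[M hM]|nM] := pselect (exists M : R, forall N, exists2 k, (N <= k)%N &
    normc (iter (n k) f a) <= M).
  have [s1 s1_homo hs1] := @subseq_exists (fun _ k => normc (iter (n k) f a) <= M) (fun _ => hM).
  have [c hc] := complex_cluster_point hs1.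
  have [|s2 s2_homo hs2] := @subseq_exists
    (fun i k => normc (iter (n (s1 k)) f a - c) < i.+1%:R^-1).
    by move=> i N; apply: hc; rewrite invr_gt0.
  exists (s1 \o s2); first by move=> i j ij; exact/s1_homo/s2_homo.
  left; exists (cst c); first by move=> z _; exact: derivable_cst.
  move=> z zd; exists [set w | normc (w - a) < d]; first exact: open_nbhs.
  apply/uniform_cvgP => e e0.
  have e20 : 0 < e / 2 by rewrite divr_gt0.
  have [N hN] := contract e20.
  have [N' hN'] := n_oo N.
  exists (maxn N' (Num.bound (e / 2)^-1)) => k; rewrite geq_max => /andP[N'k bk] w wd /=.
  rewrite hn; have -> : iter (n (s1 (s2 k))) f w - c =
    (iter (n (s1 (s2 k))) f w - iter (n (s1 (s2 k))) f a) +
    (iter (n (s1 (s2 k))) f a - c) by ring.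
  apply: le_lt_trans (normcD _ _) _; rewrite [e]splitr ltrD //.
    apply: hN => //; apply: hN'; apply: leq_trans N'k _.
    exact: leq_trans (homo_ltn_geid s2_homo _) (homo_ltn_geid s1_homo _).
  apply: lt_trans (hs2 k) _.
  rewrite invf_plt ?posrE //; apply: (@lt_le_trans _ _ (Num.bound (e / 2)^-1)%:R).
    by apply: archi_boundP; rewrite invr_ge0 ltW.
  by rewrite ler_nat; apply: leq_trans bk _.
exists id => //; right => z zd.
exists [set w | normc (w - a) < d]; first exact: open_nbhs.
move=> M; have [N hN] : exists N, forall k, (N <= k)%N -> M + 1 < normc (iter (n k) f a).
  apply: contrapT => h; apply: nM; exists (M + 1) => N; apply: contrapT => h'.
  apply: h; exists N => k Nk; rewrite ltNge; apply/negP => h1.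
  by apply: h'; exists k.
have [N1 hN1] := contract ltr01; have [N2 hN2] := n_oo N1.
exists (maxn N N2) => // k /=; rewrite geq_max => /andP[/hN h1 /hN2/hN1 h2] w /h2 h3.
rewrite hn; change (M%:C%C < (normc (iter (n k) f w))%:C%C); rewrite ltcR.
have := normcD (iter (n k) f w) (iter (n k) f a - iter (n k) f w).
rewrite addrC subrK normcB_sym; rewrite normcB_sym in h3; rewrite normcB_sym; lra.
Qed.

(** [l n] is the level of the orbit of [a] at time [n]: level 0 is the disc of radius [Rad 0], level
    [k.+1] the annulus between the circles [k] and [k.+1]. *)
Variables (Rad : nat -> R) (l : nat -> nat).
Hypothesis Rad_homo : {homo Rad : m n / (m <= n)%N >-> m <= n}.
Hypothesis Rad_oo : forall M, exists k, M < Rad k.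
Hypothesis f_circle : forall k z, normc z = Rad k -> Rad k.+1 <= normc (f z).
Hypothesis orbit_lt : forall n, normc (iter n f a) < Rad (l n).
Hypothesis orbit_ge : forall n k, l n = k.+1 -> Rad k <= normc (iter n f a).
Hypothesis l_step : forall n, (l n.+1 <= (l n).+1)%N.
Hypothesis l_top : forall j, exists2 n, (j <= l n)%N & l n.+1 = 0%N.

Local Notation U := (connected_component (Fatou f) a).

Lemma level_add n k : (l (n + k) <= l n + k)%N.
Proof.
elim: k => [|k IH]; first by rewrite !addn0.
by rewrite !addnS; apply: leq_trans (l_step _) _.
Qed.

Lemma component_self : U a.
Proof. exact/connected_component_refl/contracting_Fatou. Qed.

(** At time [n + k] the orbit of [a] has level at most [k], hence is inside circle [k], while that
    of [x] is on it or outside. So some point of [K] lands exactly on circle [k], and the next step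
    throws it out to circle [k.+1] or beyond. *)
Lemma connected_crosses_circles (K : set C) n k w : connected K -> K a -> K w ->
  l n = 0%N -> Rad 0%N <= normc (iter n f w) ->
  exists2 x, K x & Rad k <= normc (iter (n + k) f x).
Proof.
move=> Kc Ka Kw ln wn; elim: k => [|k [x Kx hx]]; first by exists w; rewrite ?addn0.
have : connected ((fun y => normc (iter (n + k) f y)) @` K).
  apply: connected_continuous_connected => //; apply: continuous_subspaceT => y A.
  move=> /nbhs_normP [e /= e0 eA].
  have [r r0 hr] := derivable_normc_continuous (@iter_derivable _ _ f_entire (n + k) y) e0.
  apply/nbhs_normcP; exists r => // v /hr vy; apply: eA; rewrite /ball_ /= ltr_norml.
  have := normcD (iter (n + k) f v - iter (n + k) f y) (iter (n + k) f y).
  have := normcD (iter (n + k) f y - iter (n + k) f v) (iter (n + k) f v).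
  rewrite !subrK normcB_sym; rewrite normcB_sym in vy; rewrite (normcB_sym (iter _ f v)).
  by move=> h1 h2; apply/andP; split; lra.
move=> /connected_intervalP /(_ _ _ (ex_intro2 _ _ a Ka erefl) (ex_intro2 _ _ x Kx erefl)).
move=> /(_ (Rad k)) [|y Ky hy].
  rewrite hx andbT; apply: ltW; apply: lt_le_trans (orbit_lt _) _; apply: Rad_homo.
  by apply: leq_trans (level_add _ _) _; rewrite ln.
by exists y => //; rewrite addnS; exact: f_circle.
Qed.

(** If [w] were outside at a time [n] of level 0, the circles crossed since then would force
    unbounded values on [K] at the later return times, where the iterates are uniformly bounded on
    [K]. *)
Lemma component_visit n : (iter n f @` U `<=` [set z | normc z < Rad 0%N]) <-> l n = 0%N.
Proof.
split.
  move=> /(_ (iter n f a)) h; case E : (l n) => [//|k].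
  have /= := h (ex_intro2 _ _ a component_self erefl).
  rewrite ltNge => /negP; case; apply: le_trans (orbit_ge E).
  exact: Rad_homo.
move=> ln _ [w Uw <-] /=; rewrite ltNge; apply/negP => wn.
have /choice [t ht] : forall j, exists t, (j <= l t)%N /\ l t.+1 = 0%N.
  by move=> j; have [t ? ?] := l_top j; exists t.
have [||K [Kc Ka Kw [M hM]]] := @Fatou_component_bounded _ _ _ _ _
   (fun j => iter (t j).+1 f) (Rad 0%N) component_self Uw.
- by move=> j; exists (t j).+1.
- by move=> j; have := orbit_lt (t j).+1; rewrite (proj2 (ht j)) => /ltW.
have [k hk] := Rad_oo M.
(* Levels rise by at most 1 per step, so a level of at least [j] is not reached before time
   [n + k]. *)
pose j := (n + k + l 0)%N.
have tj : (n + k <= t j)%N.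
  have := leq_trans (proj1 (ht j)) (level_add 0 (t j)).
  by rewrite /j; lia.
have [x Kx] := connected_crosses_circles ((t j).+1 - n) Kc Ka Kw ln wn.
rewrite subnKC; last by apply: leq_trans (leqnSn _); apply: leq_trans tj; exact: leq_addr.
move=> h; have := le_trans h (hM j x Kx); rewrite leNgt => /negP; apply.
apply: lt_le_trans hk _; apply: Rad_homo.
by rewrite leq_subRL; lia.
Qed.

(* If [iter n f z = iter m f z'] with [n < m], then [iter t f z] is bounded along
   the times [t] just before a return, since [iter (t + (m - n)) f z'] is; but
   the orbit of [a] is unbounded along these times. *)
Lemma component_wandering : wandering_domain f U.
Proof.
split; first by exists a => //; exact: contracting_Fatou.
suff main n m : (n < m)%N -> ~ (iter n f @` U `&` iter m f @` U !=set0).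
  move=> n m h; have [nm|mn|//] := ltngtP n m; exfalso.
    exact: main nm h.
  by apply: main mn _; rewrite setIC.
move=> nm [_ [[z Uz <-] [z' Uz' zz']]].
pose p := (m - n)%N.
(* The summands [n + l 0 + 1] force [n < t j]; the summand [j] makes the orbit of [a] unbounded
   along [t]. *)
have /choice [t ht] : forall j, exists t, (j + n + l 0 + 1 <= l t)%N /\ l t.+1 = 0%N.
  by move=> j; have [t ? ?] := l_top (j + n + l 0 + 1); exists t.
have tn j : (n < t j)%N.
  have := leq_trans (proj1 (ht j)) (level_add 0 (t j)); lia.
have [||K [_ _ Kz' [M hM]]] := @Fatou_component_bounded _ _ _ _ _
   (fun j => iter (t j + p) f) (Rad p) component_self Uz'.
- by move=> j; exists (t j + p)%N => //; have := tn j; lia.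
(* The return to level 0 happens at time [t j + 1], so the level at time [t j + p] is at most
   [p - 1]. *)
- move=> j; apply: ltW; apply: lt_le_trans (orbit_lt _) _; apply: Rad_homo.
  have := level_add (t j).+1 (p - 1); rewrite (proj2 (ht j)).
  have -> : ((t j).+1 + (p - 1) = t j + p)%N by rewrite /p; lia.
  by move=> /leq_trans; apply; rewrite leq_subr.
have [||K2 [_ _ K2a [M2 hM2]]] := @Fatou_component_bounded _ _ _ _ _
   (fun j => iter (t j) f) M Uz component_self.
- by move=> j; exists (t j) => //; have := tn j; lia.
- move=> j; have -> : iter (t j) f z = iter (t j + p) f z'.
    transitivity (iter (t j - n) f (iter n f z)).
      by rewrite -iterD subnK // ltnW.
    rewrite -zz' -iterD; congr (iter _ f z').
    by have := tn j; rewrite /p; lia.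
  exact: hM.
have [k hk] := Rad_oo M2.
have := hM2 k _ K2a; apply/negP; rewrite -ltNge; apply: lt_le_trans hk _.
case E : (l (t k)) => [|q]; first by have [+ _] := ht k; rewrite E addn1.
apply: le_trans (orbit_ge E); apply: Rad_homo.
by have [+ _] := ht k; rewrite E; lia.
Qed.

End OscillatingOrbit.

(** * Discs centred at 0 *)

Section Disc.
Variables (R : realType) (r : R).
Hypothesis r_gt0 : 0 < r.
Let D : set R[i] := [set z | normc z < r].

Lemma disc_domain : domain D.
Proof.
split.
- by exists 0; rewrite /D /mkset normc0.
- move=> w /= wd; apply/nbhs_normcP; exists (r - normc w); first by rewrite subr_gt0.
  move=> v vw; rewrite /D /=; have -> : v = (v - w) + w by ring.
  by apply: le_lt_trans (normcD _ _) _; rewrite -ltrBrDr.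
have /choice [S hS] := fun w : R[i] => segment_connectedC 0 w.
have -> : D = \bigcup_(w in D) S w.
  apply/seteqP; split => [w Dw|u [w Dw Su]].
    by exists w => //; case: (hS w).
  have [_ _ _ h] := hS w; have := h u 0 r Su; rewrite !subr0; apply => //.
  by rewrite normc0.
apply: bigcup_connected; last by move=> w _; case: (hS w).
by exists 0 => w _; case: (hS w).
Qed.

Lemma disc_bounded : bounded_set D.
Proof.
exists r%:C%C; split; first by rewrite complex_real.
move=> x rx y Dy; apply: ltW; apply: lt_trans rx.
by change ((normc y)%:C%C < r%:C%C); rewrite ltcR.
Qed.
End Disc.

(** * Polynomial approximation *)

Section RealPolynomials.
Variable R : realType.
Local Notation C := (R[i]).
Implicit Types (p q : {poly R}) (r c : R) (z h : C).

(** Coefficients stay real so that the intermediate value theorem applies on the real axis, while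
    estimates are made at complex points. *)
Definition ev p z : C := (map_poly (real_complex R) p).[z].

Lemma evD p q z : ev (p + q) z = ev p z + ev q z.
Proof. by rewrite /ev rmorphD hornerD. Qed.
Lemma evB p q z : ev (p - q) z = ev p z - ev q z.
Proof. by rewrite /ev rmorphB hornerD hornerN. Qed.
Lemma evM p q z : ev (p * q) z = ev p z * ev q z.
Proof. by rewrite /ev rmorphM hornerM. Qed.
Lemma evC c z : ev c%:P z = c%:C%C.
Proof. by rewrite /ev map_polyC hornerC. Qed.
Lemma evX z : ev 'X z = z.
Proof. by rewrite /ev map_polyX hornerX. Qed.
Lemma evXn p n z : ev (p ^+ n) z = ev p z ^+ n.
Proof. by rewrite /ev rmorphXn horner_exp. Qed.
Lemma ev_real p (x : R) : ev p x%:C%C = (p.[x])%:C%C.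
Proof. by rewrite /ev horner_map. Qed.

(* [cnorm r p] is the sum of the [`|p_i| * r ^+ i]; it is submultiplicative and
   controls [p] and its Taylor remainders on the disc of radius [r]. *)
Definition cnorm r p : R := foldr (fun a s => `|a| + r * s) 0 p.

Lemma cnorm0 r : cnorm r 0 = 0.
Proof. by rewrite /cnorm polyseq0. Qed.
Lemma cnorm_MXaddC r p c : cnorm r (p * 'X + c%:P) = `|c| + r * cnorm r p.
Proof.
rewrite -cons_poly_def /cnorm polyseq_cons.
case: ifPn => //; rewrite negbK => /nilP ->; rewrite polyseqC /=.
by case: eqVneq => [->|] /=; rewrite ?normr0 mulr0 ?addr0.
Qed.
Lemma cnormC r c : cnorm r c%:P = `|c|.
Proof. by rewrite -[c%:P]add0r -[0](mul0r 'X) cnorm_MXaddC cnorm0 mulr0 addr0. Qed.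
Lemma cnormX r : cnorm r 'X = r.
Proof.
have -> : 'X = 1%:P * 'X + 0%:P :> {poly R} by rewrite mul1r addr0.
by rewrite cnorm_MXaddC cnormC normr0 normr1 add0r mulr1.
Qed.

Variable r : R.
Hypothesis r_ge0 : 0 <= r.

Lemma cnorm_ge0 p : 0 <= cnorm r p.
Proof. by elim/poly_ind: p => [|p c IH]; rewrite ?cnorm0 // cnorm_MXaddC addr_ge0 // mulr_ge0. Qed.

Lemma cnormD p q : cnorm r (p + q) <= cnorm r p + cnorm r q.
Proof.
elim/poly_ind: p q => [|p c IH] q; first by rewrite add0r cnorm0 add0r.
elim/poly_ind: q => [|q d _]; first by rewrite addr0 cnorm0 addr0.
have -> : p * 'X + c%:P + (q * 'X + d%:P) = (p + q) * 'X + (c + d)%:P.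
  by rewrite polyCD; ring.
rewrite !cnorm_MXaddC.
have := ler_wpM2l r_ge0 (IH q); have := ler_normD c d; lra.
Qed.

Lemma cnormZ c p : cnorm r (c%:P * p) = `|c| * cnorm r p.
Proof.
elim/poly_ind: p => [|p d IH]; first by rewrite mulr0 cnorm0 mulr0.
have -> : c%:P * (p * 'X + d%:P) = (c%:P * p) * 'X + (c * d)%:P.
  by rewrite polyCM; ring.
by rewrite !cnorm_MXaddC IH normrM; ring.
Qed.

Lemma cnormM p q : cnorm r (p * q) <= cnorm r p * cnorm r q.
Proof.
elim/poly_ind: p => [|p c IH]; first by rewrite mul0r cnorm0 mul0r.
have -> : (p * 'X + c%:P) * q = (p * q * 'X + 0%:P) + c%:P * q by rewrite addr0; ring.
apply: le_trans (cnormD _ _) _; rewrite !cnorm_MXaddC cnormZ normr0.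
have := ler_wpM2l r_ge0 IH; lra.
Qed.

Lemma cnormB p q : cnorm r (p - q) <= cnorm r p + cnorm r q.
Proof.
apply: le_trans (cnormD _ _) _.
have -> : - q = (- 1)%:P * q by rewrite polyCN mulN1r.
by rewrite cnormZ normrN1 mul1r.
Qed.

Lemma ev_MXaddC p c z : ev (p * 'X + c%:P) z = ev p z * z + c%:C%C.
Proof. by rewrite evD evM evX evC. Qed.

Lemma ev_le p z : normc z <= r -> normc (ev p z) <= cnorm r p.
Proof.
move=> zr; elim/poly_ind: p => [|p c IH].
  by rewrite -[0]/(0%:P) evC normc_real normr0 cnorm0.
rewrite ev_MXaddC cnorm_MXaddC; apply: le_trans (normcD _ _) _.
rewrite normcM normc_real [leRHS]addrC lerD2r mulrC.
by apply: ler_pM => //; exact: normc_ge0.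
Qed.

(** A Cauchy estimate by induction along Horner's scheme: each step multiplies the bound by
    [normc z + rho], at most [r]. The second-order version below follows the same pattern. *)
Lemma ev_diff_le p z h (rho : R) : 0 < rho -> normc h <= rho -> normc z + rho <= r ->
  normc (ev p (z + h) - ev p z) <= normc h / rho * cnorm r p.
Proof.
move=> rho0 hr zr; have h0 := normc_ge0 h; have z0 := normc_ge0 z.
elim/poly_ind: p => [|p c IH].
  by rewrite -[0]/(0%:P) !evC subrr normc0 cnorm0 mulr0.
rewrite !ev_MXaddC cnorm_MXaddC.
have -> : ev p (z + h) * (z + h) + c%:C%C - (ev p z * z + c%:C%C) =
  z * (ev p (z + h) - ev p z) + h * ev p (z + h) by ring.
apply: le_trans (normcD _ _) _; rewrite !normcM.
have H1 := ler_wpM2l z0 IH.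
have H2 : normc (ev p (z + h)) <= cnorm r p.
  by apply: ev_le; apply: le_trans (normcD _ _) _; lra.
have {}H2 := ler_wpM2l h0 H2.
apply: le_trans (lerD H1 H2) _.
set k := cnorm r p; have k0 : 0 <= k := cnorm_ge0 p.
have hh : normc h = normc h / rho * rho by rewrite divfK // gt_eqF.
have q0 : 0 <= normc h / rho by rewrite divr_ge0 // ltW.
rewrite {2}hh; move: q0; set t := normc h / rho => q0.
have -> : normc z * (t * k) + t * rho * k = t * ((normc z + rho) * k) by ring.
by rewrite ler_wpM2l //; apply: ler_wpDl => //; rewrite ler_wpM2r.
Qed.

Lemma ev_taylor_le p z h (rho : R) : 0 < rho -> normc h <= rho -> normc z + rho <= r ->
  normc (ev p (z + h) - ev p z - ev p^`() z * h) <= (normc h / rho) ^+ 2 * cnorm r p.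
Proof.
move=> rho0 hr zr; have h0 := normc_ge0 h; have z0 := normc_ge0 z.
elim/poly_ind: p => [|p c IH].
  by rewrite deriv0 -[0]/(0%:P) !evC mul0r !subr0 normc0 cnorm0 mulr0.
rewrite derivD derivC addr0 derivM derivX mulr1 !ev_MXaddC cnorm_MXaddC evD evM evX.
have -> : ev p (z + h) * (z + h) + c%:C%C - (ev p z * z + c%:C%C)
   - (ev p^`() z * z + ev p z) * h =
  z * (ev p (z + h) - ev p z - ev p^`() z * h) + h * (ev p (z + h) - ev p z) by ring.
apply: le_trans (normcD _ _) _; rewrite !normcM.
have H1 := ler_wpM2l z0 IH.
have H2 := ler_wpM2l h0 (ev_diff_le p rho0 hr zr).
apply: le_trans (lerD H1 H2) _.
set k := cnorm r p; have k0 : 0 <= k := cnorm_ge0 p.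
have hh : normc h = normc h / rho * rho by rewrite divfK // gt_eqF.
have q0 : 0 <= normc h / rho by rewrite divr_ge0 // ltW.
rewrite {2}hh; move: q0; set t := normc h / rho => q0.
have -> : normc z * (t ^+ 2 * k) + t * rho * (t * k) = t ^+ 2 * ((normc z + rho) * k) by ring.
by rewrite ler_wpM2l ?exprn_ge0 //; apply: ler_wpDl => //; rewrite ler_wpM2r.
Qed.

End RealPolynomials.

(** * Iteration of the cubic step polynomial *)

Section SmoothStep.
Variable R : realType.
Local Notation C := (R[i]).
Implicit Types (p : {poly R}) (z w : C).

(* [3 w^2 - 2 w^3] has superattracting fixed points at 0 and 1, and infinity. *)
Definition smooth_step (p : {poly R}) : {poly R} := 3%:P * p ^+ 2 - 2%:P * p ^+ 3.

Lemma ev_smooth_step p z : ev (smooth_step p) z = 3 * ev p z ^+ 2 - 2 * ev p z ^+ 3.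
Proof. by rewrite /smooth_step evB !(evM, evC, evXn) !rmorph_nat. Qed.

Lemma normc_nat n : normc (n%:R : C) = n%:R.
Proof. by rewrite -(rmorph_nat (real_complex R)) normc_real ger0_norm. Qed.

(** Stated for [cnorm] rather than for values, so that derivatives become small too. Below 1/10 one
    step multiplies by at most 3/10 + 2/100, which is less than 1/2. *)
Lemma cnorm_smooth_step_iter (r : R) p n : 0 <= r -> cnorm r p <= 10^-1 ->
  cnorm r (iter n smooth_step p) <= 10^-1 / 2 ^+ n.
Proof.
move=> r0 hp; elim: n => [|n IH]; first by rewrite expr0 divr1.
rewrite iterS; move: IH; set q := iter n smooth_step p => IH.
have q0 := cnorm_ge0 r0 q.
have qs : cnorm r q <= 10^-1.
  apply: le_trans IH _; rewrite ler_pdivrMr ?exprn_gt0 // ler_peMr //.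
  by rewrite exprn_ege1 // ler1n.
have -> : 10^-1 / 2 ^+ n.+1 = 2^-1 * (10^-1 / 2 ^+ n) :> R by rewrite exprS invfM mulrCA.
apply: (@le_trans _ _ (2^-1 * cnorm r q)); last first.
  by rewrite ler_wpM2l.
have q2 : cnorm r (q ^+ 2) <= cnorm r q ^+ 2 by rewrite !expr2; exact: cnormM.
have q3 : cnorm r (q ^+ 3) <= cnorm r q ^+ 3.
  rewrite !(exprS _ 2); apply: le_trans (cnormM _ _ _) _ => //.
  by rewrite ler_wpM2l.
rewrite /smooth_step; apply: le_trans (cnormB _ _ _) _ => //.
rewrite !cnormZ // !ger0_norm //.
have x2 : cnorm r q ^+ 2 <= 10^-1 * cnorm r q by rewrite expr2 ler_wpM2r.
have x3 : cnorm r q ^+ 3 <= 10^-1 * cnorm r q ^+ 2.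
  by rewrite exprS ler_wpM2r // exprn_ge0.
lra.
Qed.

Lemma smooth_step_iter_near0 p z n : normc (ev p z) <= 10^-1 ->
  normc (ev (iter n smooth_step p) z) <= 10^-1 / 2 ^+ n.
Proof.
move=> hp; elim: n => [|n IH]; first by rewrite expr0 divr1.
rewrite iterS ev_smooth_step; move: IH; set q := ev _ z => IH.
have q0 := normc_ge0 q.
have qs : normc q <= 10^-1.
  apply: le_trans IH _; rewrite ler_pdivrMr ?exprn_gt0 // ler_peMr //.
  by rewrite exprn_ege1 // ler1n.
have -> : 10^-1 / 2 ^+ n.+1 = 2^-1 * (10^-1 / 2 ^+ n) :> R by rewrite exprS invfM mulrCA.
apply: (@le_trans _ _ (2^-1 * normc q)); last first.
  by rewrite ler_wpM2l.
have -> : 3 * q ^+ 2 - 2 * q ^+ 3 = q * (q * (3 - 2 * q)) by ring.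
rewrite !normcM mulrC ler_wpM2r //.
have h3 : normc (3 - 2 * q) <= 3 + 2 * normc q.
  by apply: le_trans (normcD _ _) _; rewrite (@normcN R (2 * q)) normcM !normc_nat.
have : normc q * normc (3 - 2 * q) <= 10^-1 * (3 + 2 * 10^-1).
  by apply: ler_pM => //; [exact: normc_ge0|lra].
lra.
Qed.

Lemma smooth_step_iter_near1 p z n : normc (ev p z - 1) <= 10^-1 ->
  normc (ev (iter n smooth_step p) z - 1) <= 10^-1 / 2 ^+ n.
Proof.
move=> hp; elim: n => [|n IH]; first by rewrite expr0 divr1.
rewrite iterS ev_smooth_step; move: IH; set q := ev _ z => IH.
have q0 := normc_ge0 (q - 1).
have qs : normc (q - 1) <= 10^-1.
  apply: le_trans IH _; rewrite ler_pdivrMr ?exprn_gt0 // ler_peMr //.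
  by rewrite exprn_ege1 // ler1n.
have -> : 10^-1 / 2 ^+ n.+1 = 2^-1 * (10^-1 / 2 ^+ n) :> R by rewrite exprS invfM mulrCA.
apply: (@le_trans _ _ (2^-1 * normc (q - 1))); last first.
  by rewrite ler_wpM2l.
have -> : 3 * q ^+ 2 - 2 * q ^+ 3 - 1 = (q - 1) * ((q - 1) * - (3 + 2 * (q - 1))) by ring.
rewrite !normcM mulrC ler_wpM2r //.
have h3 : normc (- (3 + 2 * (q - 1))) <= 3 + 2 * normc (q - 1).
  rewrite (@normcN R); apply: le_trans (normcD _ _) _.
  by rewrite normcM !normc_nat.
have : normc (q - 1) * normc (- (3 + 2 * (q - 1))) <= 10^-1 * (3 + 2 * 10^-1).
  by apply: ler_pM => //; [exact: normc_ge0|lra].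
lra.
Qed.

Lemma smooth_step_iter_large p z n : 3 <= normc (ev p z) ->
  3 * 2 ^+ n <= normc (ev (iter n smooth_step p) z).
Proof.
move=> hp; elim: n => [|n IH]; first by rewrite expr0 mulr1.
rewrite iterS ev_smooth_step; move: IH; set q := ev _ z => IH.
have qs : 3 <= normc q.
  by apply: le_trans IH; rewrite ler_peMr // exprn_ege1 // ler1n.
have -> : 3 * 2 ^+ n.+1 = 2 * (3 * 2 ^+ n) :> R by rewrite exprS mulrCA.
apply: (@le_trans _ _ (2 * normc q)); first by rewrite ler_wpM2l.
have -> : 3 * q ^+ 2 - 2 * q ^+ 3 = q * (q * (3 - 2 * q)) by ring.
rewrite !normcM mulrC ler_wpM2l ?normc_ge0 //.
have h3 : 2 * normc q - 3 <= normc (3 - 2 * q).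
  have := normcD 3 (- (3 - 2 * q)); rewrite (@normcN R) normc_nat.
  have -> : 3 - (3 - 2 * q) = 2 * q by ring.
  by rewrite normcM !normc_nat; lra.
have : 3 * 3 <= normc q * normc (3 - 2 * q) by apply: ler_pM => //; lra.
lra.
Qed.

End SmoothStep.

Section Approximation.
Variable R : realType.
Local Notation C := (R[i]).

Lemma exp2_unbounded (x : R) : exists n, x <= 2 ^+ n.
Proof.
exists (Num.bound `|x|); apply: le_trans (ler_norm x) _.
apply: (@le_trans _ _ (Num.bound `|x|)%:R); first exact/ltW/archi_boundP/normr_ge0.
by rewrite -natrX ler_nat ltnW // ltn_expl.
Qed.

Lemma exp2_small (K e : R) : 0 < e -> exists m, forall n, (m <= n)%N ->
  10^-1 / 2 ^+ n * K <= e / 2.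
Proof.
move=> e0; have [m hm] := exp2_unbounded (K / e); exists m => n mn.
have : K / e <= 2 ^+ n by apply: le_trans hm _; rewrite ler_eXn2l // ltr1n.
rewrite ler_pdivrMr // => h.
have p0 : 0 < 2 ^+ n :> R by rewrite exprn_gt0.
rewrite mulrAC ler_pdivrMr //; nra.
Qed.

(* Adds to [p] the term [chi * (A - p + psi * (v - A))], where [A] is the affine
   target, [chi] is nearly 0 on the disc of radius [r] and nearly 1 around [b],
   and [psi] is nearly 0 around [b] and nearly 1 around [b + 10]. *)
Lemma polynomial_refinement (p : {poly R}) (r b b' v e M : R) :
  0 <= r -> 110 <= b -> 10 * r <= b -> `|v| <= 1 -> 100 * b <= b' -> 0 < e ->
  exists q : {poly R}, [/\ cnorm r (q - p) <= e,
    forall z : C, normc (z - b%:C%C) <= 1 ->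
      normc (ev q z - (b'%:C%C + 20 * (z - b%:C%C))) <= e,
    forall z : C, normc (z - (b + 10)%:C%C) <= 1 -> normc (ev q z - v%:C%C) <= e &
    forall z : C, normc z = 3 * b -> M <= normc (ev q z)].
Proof.
move=> r0 b110 rb v1 bb' e0.
have b0 : 0 < b by lra.
pose A : {poly R} := b'%:P + 20%:P * ('X - b%:P).
have evA z : ev A z = b'%:C%C + 20 * (z - b%:C%C).
  by rewrite /A !(evB, evD, evM, evC, evX) rmorph_nat.
(* This seed is within 1/10 of 0 on the unit disc around [b], within 1/10 of 1 on the one around
   [b + 10], and at least 3 in modulus on the circle of radius [3 * b]. *)
pose hpsi : {poly R} := (10^-1)%:P * ('X - b%:P).
have evh z : ev hpsi z = (10^-1)%:C%C * (z - b%:C%C).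
  by rewrite /hpsi !(evM, evB, evC, evX).
(* This seed has [cnorm] at most 1/10 for the radius [r], is within 1/10 of 1 at distance at most 11
   from [b] (hence the bound 110), and has modulus 3 on the circle of radius [3 * b]. *)
pose hchi : {poly R} := (b^-1)%:P * 'X.
have evc z : ev hchi z = (b^-1)%:C%C * z by rewrite /hchi !(evM, evC, evX).
have b30 : 0 <= 3 * b by lra.
pose K1 := cnorm (3 * b) (A - p); pose K2 := cnorm (3 * b) (v%:P - A).
(* [psi] is fixed first: [n1] makes its errors small on both unit discs, [n2] makes [G] at least 1
   on the circle. Only then is [chi] chosen: [m1] and [m2] make its errors times [G] small, [m3]
   makes it dominate [p] and [M] on the circle. *)
have [n1 hn1] := exp2_small K2 e0.
have [n2 hn2] := exp2_unbounded (K1 + 1).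
pose psi := iter (maxn n1 n2) (@smooth_step R) hpsi.
pose G := A - p + psi * (v%:P - A).
have [m1 hm1] := exp2_small (cnorm (3 * b) G) e0.
have [m2 hm2] := exp2_small (cnorm r G) e0.
have [m3 hm3] := exp2_unbounded (cnorm (3 * b) p + `|M|).
pose m := maxn m1 (maxn m2 m3).
pose chi := iter m (@smooth_step R) hchi.
have mm1 : (m1 <= m)%N by rewrite leq_maxl.
have mm2 : (m2 <= m)%N by rewrite /m leq_max leq_maxl orbT.
have mm3 : (m3 <= m)%N by rewrite /m !leq_max leqnn !orbT.
have evG z : ev G z = ev A z - ev p z + ev psi z * (v%:C%C - ev A z).
  by rewrite /G !(evB, evD, evM, evC).
have evq z : ev (p + chi * G) z = ev p z + ev chi z * ev G z.
  by rewrite !(evD, evM).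
have evVA z : normc z <= 3 * b -> normc (v%:C%C - ev A z) <= K2.
  by move=> zb; have := ev_le (v%:P - A) zb; rewrite evB evC.
have disc z : normc (z - b%:C%C) <= 11 -> normc z <= 3 * b /\
    normc (ev chi z - 1) <= 10^-1 / 2 ^+ m.
  move=> zb; split.
    by have := normcD (z - b%:C%C) b%:C%C; rewrite subrK normc_real gtr0_norm //; lra.
  apply: smooth_step_iter_near1; rewrite evc.
  have -> : (b^-1)%:C%C * z - 1 = (b^-1)%:C%C * (z - b%:C%C).
    by rewrite mulrBr -rmorphM mulVf ?gt_eqF.
  rewrite normcM normc_real gtr0_norm ?invr_gt0 // mulrC ler_pdivrMr //; lra.
have chiG z : normc (z - b%:C%C) <= 11 -> normc ((ev chi z - 1) * ev G z) <= e / 2.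
  move=> zb; have [z3 hz] := disc _ zb.
  rewrite normcM; apply: le_trans (hm1 _ mm1).
  by apply: ler_pM; rewrite ?normc_ge0 //; exact: ev_le.
exists (p + chi * G); split.
- rewrite addrC addKr; apply: le_trans (cnormM r0 _ _) _.
  apply: (@le_trans _ _ (e / 2)); last by lra.
  apply: le_trans (hm2 _ mm2); rewrite ler_wpM2r ?cnorm_ge0 //.
  apply: cnorm_smooth_step_iter => //.
  rewrite /hchi cnormZ // cnormX gtr0_norm ?invr_gt0 // mulrC ler_pdivrMr //; lra.
- move=> z zb; have [|z3 hz] := disc z; first lra.
  have -> : ev (p + chi * G) z - (b'%:C%C + 20 * (z - b%:C%C)) =
    (ev chi z - 1) * ev G z + ev psi z * (v%:C%C - ev A z).
    by rewrite evq -evA !evG; ring.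
  apply: le_trans (normcD _ _) _; rewrite [e]splitr; apply: lerD; first by apply: chiG; lra.
  rewrite normcM; apply: le_trans (hn1 _ (leq_maxl n1 n2)).
  apply: ler_pM; rewrite ?normc_ge0 ?evVA //.
  apply: smooth_step_iter_near0; rewrite evh normcM normc_real ger0_norm //; lra.
- move=> z zb.
  have zb' : normc (z - b%:C%C) <= 11.
    have := normcD (z - (b + 10)%:C%C) 10; rewrite normc_nat.
    have -> : z - (b + 10)%:C%C + 10 = z - b%:C%C by rewrite rmorphD rmorph_nat; ring.
    lra.
  have [z3 hz] := disc z zb'.
  have -> : ev (p + chi * G) z - v%:C%C =
    (ev chi z - 1) * ev G z + (ev psi z - 1) * (v%:C%C - ev A z).
    by rewrite evq !evG; ring.
  apply: le_trans (normcD _ _) _; rewrite [e]splitr; apply: lerD; first exact: chiG.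
  rewrite normcM; apply: le_trans (hn1 _ (leq_maxl n1 n2)).
  apply: ler_pM; rewrite ?normc_ge0 ?evVA //.
  apply: smooth_step_iter_near1; rewrite evh.
  have -> : (10^-1)%:C%C * (z - b%:C%C) - 1 = (10^-1)%:C%C * (z - (b + 10)%:C%C).
    have k : (10^-1)%:C%C * 10 = 1 :> C by rewrite -(rmorph_nat (real_complex R)) -rmorphM mulVf.
    by rewrite rmorphD rmorph_nat -[X in _ - X = _]k; ring.
  rewrite normcM normc_real ger0_norm //; lra.
move=> z zb.
have z3 : normc z <= 3 * b by rewrite zb.
have psi_large : 3 * (K1 + 1) <= normc (ev psi z).
  apply: (@le_trans _ _ (3 * 2 ^+ maxn n1 n2)).
    by rewrite ler_wpM2l //; apply: le_trans hn2 _; rewrite ler_eXn2l ?ltr1n // leq_maxr.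
  apply: smooth_step_iter_large; rewrite evh normcM normc_real ger0_norm //.
  have := normcD (z - b%:C%C) b%:C%C; rewrite subrK zb normc_real gtr0_norm //; lra.
(* The linear part of [A] has modulus at most [80 * b], against [b'] at least [100 * b] and [v] at
   most 1 in modulus. *)
have VA1 : 1 <= normc (v%:C%C - ev A z).
  rewrite evA normcB_sym.
  have := normcD (b'%:C%C + 20 * (z - b%:C%C) - v%:C%C) (v%:C%C - 20 * (z - b%:C%C)).
  have -> : b'%:C%C + 20 * (z - b%:C%C) - v%:C%C + (v%:C%C - 20 * (z - b%:C%C)) = b'%:C%C by ring.
  have := normcD v%:C%C (- (20 * (z - b%:C%C))).
  have := normcD z (- b%:C%C).
  rewrite !(@normcN R) normcM !normc_nat !normc_real zb.
  rewrite (gtr0_norm b0) (@gtr0_norm _ b'); lra.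
have K10 : 0 <= K1 by exact: cnorm_ge0.
have G1 : 1 <= normc (ev G z).
  have H1 : normc (ev A z - ev p z) <= K1 by rewrite -evB; exact: ev_le.
  have H2 : 3 * (K1 + 1) <= normc (ev psi z * (v%:C%C - ev A z)).
    rewrite normcM; apply: le_trans psi_large _.
    by rewrite ler_peMr // normc_ge0.
  have := normcD (ev G z) (- (ev A z - ev p z)).
  have -> : ev G z - (ev A z - ev p z) = ev psi z * (v%:C%C - ev A z) by rewrite evG; ring.
  rewrite (@normcN R); lra.
have chi_large : 3 * (cnorm (3 * b) p + `|M|) <= normc (ev chi z).
  apply: (@le_trans _ _ (3 * 2 ^+ m)).
    by rewrite ler_wpM2l //; apply: le_trans hm3 _; rewrite ler_eXn2l ?ltr1n.
  apply: smooth_step_iter_large; rewrite evc normcM zb normc_real gtr0_norm ?invr_gt0 //.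
  by rewrite mulrCA mulVf ?gt_eqF // mulr1.
have H3 := ev_le p z3.
have p30 := cnorm_ge0 b30 p.
have H4 : 3 * (cnorm (3 * b) p + `|M|) <= normc (ev chi z * ev G z).
  by rewrite normcM; apply: le_trans chi_large _; rewrite ler_peMr // normc_ge0.
have := normcD (ev (p + chi * G) z) (- ev p z).
have -> : ev (p + chi * G) z - ev p z = ev chi z * ev G z by rewrite evq; ring.
rewrite (@normcN R); have := ler_norm M; have := normr_ge0 M; lra.
Qed.

End Approximation.

(** * Construction of the entire function *)

Section Stages.
Variable R : realType.
Local Notation C := (R[i]).
Implicit Types (p q : {poly R}).

(** The numbers fit [polynomial_refinement] at [cen k.+1]: its circle of radius [3 * b] is circle
    [k.+1], and [10 * Rad k] is at most [cen k.+1]. *)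
Definition Rad (k : nat) : R := 30 * 100 ^+ k.
Definition cen (k : nat) : R := if k is 0%N then 0 else 10 * 100 ^+ k.
(** Slope 20 covers the next unit disc in spite of an error 1, and takes the offset 1/2 from [cen k]
    to the offset 10 of the next hole. At level 0, slope 2000 reaches both zone 0 and zone 1, which
    is centred at 1000. *)
Definition aff (k : nat) (z : C) : C :=
  if k is 0%N then 2000 * z else (cen k.+1)%:C%C + 20 * (z - (cen k)%:C%C).

Lemma Rad_ge k : 30 <= Rad k.
Proof. by rewrite /Rad ler_peMr // exprn_ege1 // ler1n. Qed.
Lemma RadS k : Rad k.+1 = 100 * Rad k.
Proof. by rewrite /Rad exprS mulrCA. Qed.
Lemma Rad_cen k : Rad k.+1 = 3 * cen k.+1.
Proof. by rewrite /Rad /cen; lra. Qed.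
Lemma cen_ge k : 1000 <= cen k.+1.
Proof. have := Rad_ge k; have := Rad_cen k; rewrite RadS; lra. Qed.
Lemma cen_le k : cen k + 3 <= Rad k.
Proof.
case: k => [|k]; first by rewrite /cen /Rad; lra.
have := cen_ge k; rewrite Rad_cen; lra.
Qed.
Lemma cen_Rad k : Rad k + 2 <= cen k.+1.
Proof. have := Rad_cen k; have := Rad_ge k; rewrite RadS; lra. Qed.
Lemma cenSS k : cen k.+2 = 100 * cen k.+1.
Proof. have := Rad_cen k; have := Rad_cen k.+1; rewrite RadS; lra. Qed.
Lemma cen_ge0 k : 0 <= cen k.
Proof. case: k => [|k]; first exact: lexx. have := cen_ge k; lra. Qed.
Lemma Rad_homo : {homo Rad : m n / (m <= n)%N >-> m <= n}.
Proof. by move=> m n mn; rewrite /Rad ler_wpM2l // ler_weXn2l // ler1n. Qed.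

Definition on_zone k p := forall z : C, normc (z - (cen k)%:C%C) <= 1 ->
  normc (ev p z - aff k z) <= 1.

Lemma real_on_zone k p (x : R) : on_zone k p -> `|x - cen k| <= 1 ->
  `|p.[x] - (if k is 0%N then 2000 * x else cen k.+1 + 20 * (x - cen k))| <= 1.
Proof.
move=> hp hx; have := hp x%:C%C; rewrite -rmorphB normc_real ev_real => /(_ hx).
case: k {hp hx} => [|k]; rewrite /aff.
  by rewrite -(rmorph_nat (real_complex R)) -rmorphM -rmorphB normc_real.
by rewrite -(rmorph_nat (real_complex R)) -rmorphB -rmorphM -rmorphD -rmorphB normc_real.
Qed.

(** The intermediate value theorem: the values at the ends of the zone overshoot the target
    interval. That zone 0 also covers itself is what permits waiting near 0. *)
Lemma zone_covers k k' p (y : R) : on_zone k p -> k' = k.+1 \/ k = 0%N /\ k' = 0%N ->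
  `|y - cen k'| <= 1 -> exists2 x : R, `|x - cen k| <= 1 & p.[x] = y.
Proof.
move=> hp kk' hy.
have hm : `|cen k - 1 - cen k| <= 1 by rewrite addrAC subrr add0r normrN1.
have hM : `|cen k + 1 - cen k| <= 1 by rewrite addrAC subrr add0r normr1.
have := real_on_zone hp hm; have := real_on_zone hp hM; rewrite !ler_distl => h1 h2.
have [x hx] : exists2 x, cen k - 1 <= x <= cen k + 1 & root (p - y%:P) x.
  apply: poly_ivt; first by lra.
  rewrite !hornerE; move: hy h1 h2; rewrite ler_distl.
  case: kk' => [->|[-> ->]].
    case: k {hp hm hM} => [|k]; rewrite /cen ?expr1; lra.
  rewrite /cen; lra.
rewrite rootE !hornerE subr_eq0 => /eqP hr; exists x => //.
by rewrite ler_distl.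
Qed.

(* The itinerary [i - n] (truncated subtraction) stays at level 0 until time
   [n] and then climbs one level per step. *)
Lemma itinerary_exists p n K (y : R) :
  (forall k, (k < K - n)%N -> on_zone k p) -> on_zone 0 p ->
  `|y - cen (K - n)| <= 1 ->
  exists2 v : R, iter K (horner p) v = y &
    forall i, (i <= K)%N -> `|iter i (horner p) v - cen (i - n)| <= 1.
Proof.
elim: K y => [|K IH] y hz h0 hy.
  by exists y => // i; rewrite leqn0 => /eqP ->.
(* The orbit is built backwards: the end point [y] is pulled back one zone at a time. *)
have [||x hx pxy] := @zone_covers (K - n) (K.+1 - n) p y _ _ hy.
- case E : (K - n)%N => [//|q]; apply: hz; lia.
- have [nK|Kn] := leqP n K; [left|right]; lia.
have [|v hv hvi] := IH x _ h0 hx.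
  by move=> k kK; apply: hz; lia.
exists v; first by rewrite iterS hv.
move=> i; rewrite leq_eqVlt => /orP[/eqP ->|]; last exact: hvi.
by rewrite iterS hv pxy.
Qed.

(** Finite orbits depend continuously on the map and the starting point. The tolerance is uniform in
    [g], since it is fixed before the limit function exists. *)
Lemma shadowing p (v r : R) K (tau : R) : 0 < tau ->
  (forall i, (i < K)%N -> `|iter i (horner p) v| + 1 <= r) ->
  exists2 eps : R, 0 < eps & forall g : C -> C,
    (forall z, normc z <= r -> normc (g z - ev p z) <= eps) ->
    forall w, normc (w - v%:C%C) <= eps -> forall i, (i <= K)%N ->
      normc (iter i g w - (iter i (horner p) v)%:C%C) <= tau.
Proof.
elim: K tau => [|K IH] tau tau0 hr.
  by exists tau => // g hg w wv i; rewrite leqn0 => /eqP ->.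
set x := iter K (horner p) v.
pose k := cnorm r p + 1.
have xr : `|x| + 1 <= r by apply: hr.
have r0 : 0 <= r by apply: le_trans xr; rewrite addr_ge0.
have k0 : 0 < k by rewrite ltr_pwDr // cnorm_ge0.
(* The cap 1 keeps the perturbed orbit where [cnorm r p] is a Lipschitz constant; [tau / 2 / k]
   makes the propagated error at most [tau / 2], the other half being left for [g - p]. *)
pose delta := Num.min tau (Num.min 1 (tau / 2 / k)).
have d0 : 0 < delta by rewrite !lt_min tau0 ltr01 !divr_gt0.
have [|eps1 eps10 h1] := IH delta d0.
  by move=> i iK; apply: hr; lia.
exists (Num.min eps1 (tau / 2)); first by rewrite lt_min eps10 divr_gt0.
move=> g hg w wv i iK.
have {}h1 : forall i, (i <= K)%N -> normc (iter i g w - (iter i (horner p) v)%:C%C) <= delta.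
  apply: h1.
    by move=> z zr; apply: le_trans (hg z zr) _; rewrite ge_min lexx.
  by apply: le_trans wv _; rewrite ge_min lexx.
have dtau : delta <= tau by rewrite ge_min lexx.
move: iK; rewrite leq_eqVlt => /orP[/eqP ->|iK]; last exact: le_trans (h1 _ iK) dtau.
have := h1 K (leqnn K); rewrite -/x !iterS -/x; set u := iter K g w => ux.
have ux1 : normc (u - x%:C%C) <= 1.
  by apply: le_trans ux _; rewrite /delta !ge_min lexx !orbT.
have ur : normc u <= r.
  by have := normcD (u - x%:C%C) x%:C%C; rewrite subrK normc_real; lra.
have H1 : normc (g u - ev p u) <= tau / 2.
  by apply: le_trans (hg u ur) _; rewrite ge_min lexx orbT.
have xr' : normc x%:C%C + 1 <= r by rewrite normc_real.
have := ev_diff_le r0 p ltr01 ux1 xr'.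
rewrite (_ : x%:C%C + (u - x%:C%C) = u); last by rewrite addrC subrK.
rewrite ev_real divr1 => H2.
have H3 : normc (u - x%:C%C) * cnorm r p <= tau / 2.
  have : normc (u - x%:C%C) <= tau / 2 / k.
    by apply: le_trans ux _; rewrite /delta !ge_min lexx !orbT.
  rewrite ler_pdivlMr // => h; apply: le_trans h.
  by rewrite ler_wpM2l ?normc_ge0 // /k lerDl.
have -> : g u - (p.[x])%:C%C = (g u - ev p u) + (ev p u - (p.[x])%:C%C) by ring.
apply: le_trans (normcD _ _) _; lra.
Qed.

Variable stay : nat -> nat.

(* The slack [4 * e] absorbs all later corrections, whose sizes decrease at
   least by a factor 4 at each stage. *)
Definition invariant j p (e : R) := [/\ 0 < e, e <= 5^-1,
  forall k, (k <= j)%N -> forall z : C, normc (z - (cen k)%:C%C) <= 1 ->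
    normc (ev p z - aff k z) <= 1 - 4 * e &
  forall k, (k <= j)%N -> forall z : C, normc z = Rad k ->
    Rad k.+1 + 4 * e <= normc (ev p z)].

(** The time from [v] to zone [j.+1]: [stay j] steps within zone 0, then one level per step. *)
Definition climb j := (stay j + j.+1)%N.

(* [v] is the value prescribed on the [j]-th hole; [4 * e'] bounds both the
   distance from [p] to the limit function and the error in hitting [v]. *)
Definition stage j p e (v : R) q e' := [/\ 0 < e' <= e / 4,
  cnorm (Rad j) (q - p) <= e',
  forall i, (i <= climb j)%N -> `|iter i (horner p) v - cen (i - stay j)| <= 1,
  (forall g : C -> C,
    (forall z, normc z <= Rad j -> normc (g z - ev p z) <= 4 * e') ->
    forall w, normc (w - v%:C%C) <= 4 * e' -> forall i, (i <= climb j)%N ->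
      normc (iter i g w - (iter i (horner p) v)%:C%C) <= 100^-1 / 2 ^+ j) /\
  iter (climb j) (horner p) v = cen j.+1 + 2^-1 &
  (forall z : C, normc (z - (cen j.+1)%:C%C) <= 1 -> normc (ev q z - aff j.+1 z) <= e') /\
  (forall z : C, normc (z - (cen j.+1 + 10)%:C%C) <= 1 -> normc (ev q z - v%:C%C) <= e')].

(** The order of choices matters: [v] comes from the orbits of [p], the tolerance [e'] from
    shadowing the orbit of [v], and only then is [q] made to take the value [v] on the hole, up to
    [e']. The orbit ends at offset 1/2 in zone [j.+1], so that the next step enters the next
    hole. *)
Lemma stage_exists j p e : invariant j p e ->
  exists v q e', stage j p e v q e' /\ invariant j.+1 q e'.
Proof.
move=> [e0 e5 hz hc].
have hy : `|cen j.+1 + 2^-1 - cen j.+1| <= 1.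
  by rewrite addrAC subrr add0r ger0_norm; lra.
have zone k : (k <= j)%N -> on_zone k p.
  by move=> kj z zk; apply: le_trans (hz k kj z zk) _; lra.
have E : (climb j - stay j = j.+1)%N by rewrite /climb; lia.
have [|||v hv hvi] := @itinerary_exists p (stay j) (climb j) (cen j.+1 + 2^-1).
- by move=> k; rewrite E => kj; apply: zone; lia.
- exact: zone.
- by rewrite E.
have t0 : 0 < 100^-1 / 2 ^+ j :> R by rewrite divr_gt0 // exprn_gt0.
have [|eps eps0 hs] := @shadowing p v (Rad j) (climb j) _ t0.
  move=> i iK; have := hvi i (ltnW iK).
  have hh : cen (i - stay j) + 3 <= Rad j.
    by apply: le_trans (cen_le _) _; apply: Rad_homo; move: iK; rewrite /climb; lia.
  rewrite ler_distl => /andP[h1 h2]; have := cen_ge0 (i - stay j).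
  move: h1 h2 hh; set c := cen _; set y := iter _ _ _ => h1 h2 h3 c0.
  have : `|y| <= Rad j - 1 by rewrite ler_norml; apply/andP; split; lra.
  lra.
pose e' := Num.min (e / 4) (eps / 4).
have e'0 : 0 < e' by rewrite lt_min !divr_gt0.
have e'e : e' <= e / 4 by rewrite ge_min lexx.
have e'eps : 4 * e' <= eps.
  have : e' <= eps / 4 by rewrite ge_min lexx orbT.
  lra.
have v1 : `|v| <= 1 by have := hvi 0%N (leq0n _); rewrite sub0n /= subr0.
have [||||||q [hq1 hq2 hq3 hq4]] := @polynomial_refinement R p (Rad j) (cen j.+1)
  (cen j.+2) v e' (Rad j.+2 + 4 * e').
- by apply: le_trans (Rad_ge j).
- by apply: le_trans (cen_ge j); lra.
- have := Rad_cen j; have := Rad_ge j; rewrite RadS; lra.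
- exact: v1.
- by rewrite cenSS.
- exact: e'0.
have close z : normc z <= Rad j -> normc (ev q z - ev p z) <= e'.
  by move=> zr; rewrite -evB; apply: le_trans (ev_le _ zr) hq1.
exists v, q, e'; split.
  split=> //; first by rewrite e'0.
  split => // g hg w hw i iK; apply: hs => // [z zr|].
    exact: le_trans (hg z zr) _.
  exact: le_trans hw _.
split=> //; first lra.
  move=> k; rewrite leq_eqVlt => /orP[/eqP ->|kj] z zk.
    by apply: le_trans (hq2 z zk) _; lra.
  have zr : normc z <= Rad j.
    have := normcD (z - (cen k)%:C%C) (cen k)%:C%C.
    rewrite subrK normc_real ger0_norm ?cen_ge0 //.
    have := cen_le k; have := Rad_homo (kj : (k <= j)%N).
    lra.
  have -> : ev q z - aff k z = (ev q z - ev p z) + (ev p z - aff k z) by ring.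
  apply: le_trans (normcD _ _) _.
  have := close z zr; have := hz k kj z zk; lra.
move=> k; rewrite leq_eqVlt => /orP[/eqP ->|kj] z zk.
  by apply: hq4; rewrite zk Rad_cen.
have zr : normc z <= Rad j by rewrite zk; exact: (Rad_homo (kj : (k <= j)%N)).
have := hc k kj z zk; have := close z zr.
have := normcD (ev q z) (- (ev q z - ev p z)).
have -> : ev q z - (ev q z - ev p z) = ev p z by ring.
rewrite (@normcN R); lra.
Qed.

Lemma invariant0 : invariant 0 (2000%:P * 'X) 5^-1.
Proof.
have ev0 z : ev (2000%:P * 'X : {poly R}) z = 2000 * z.
  by rewrite evM evC evX rmorph_nat.
split; rewrite ?invr_gt0 ?ltr0n //.
  move=> k; rewrite leqn0 => /eqP -> z _.
  by rewrite ev0 /aff subrr normc0; lra.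
move=> k; rewrite leqn0 => /eqP -> z zk.
by rewrite ev0 normcM normc_nat zk /Rad expr0 expr1; lra.
Qed.

Lemma stages_exist : exists (p : nat -> {poly R}) (e v : nat -> R),
  forall j, invariant j (p j) (e j) /\ stage j (p j) (e j) (v j) (p j.+1) (e j.+1).
Proof.
have /choice [next hnext] : forall s : nat * ({poly R} * R), exists t : R * ({poly R} * R),
    invariant s.1 s.2.1 s.2.2 ->
    stage s.1 s.2.1 s.2.2 t.1 t.2.1 t.2.2 /\ invariant s.1.+1 t.2.1 t.2.2.
  move=> [j [p e]] /=; have [hi|ni] := pselect (invariant j p e).
    by have [v [q [e' h]]] := stage_exists hi; exists (v, (q, e')).
  (* An arbitrary default for data violating the invariant. *)
  by exists (0, (0, 0)).
pose s := fix s j := if j is j'.+1 then (next (j', s j')).2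
                     else ((2000%:P * 'X, 5^-1) : {poly R} * R).
have hs j : invariant j (s j).1 (s j).2.
  elim: j => [|j IH]; first exact: invariant0.
  by have [_] := hnext (j, s j) IH.
exists (fun j => (s j).1), (fun j => (s j).2), (fun j => (next (j, s j)).1) => j.
by split; [exact: hs|have [] := hnext (j, s j) (hs j)].
Qed.

End Stages.

(** * Limits with geometric error bounds *)

Section GeometricLimits.
Variable R : realType.
Local Notation C := (R[i]).
Variable e : nat -> R.
Hypothesis e_gt0 : forall k, 0 < e k.
Hypothesis e_step : forall k, e k.+1 <= e k / 4.

(** The limit is the supremum of the lower bounds [u k - 2 * e k.+1], each of which is below every
    upper bound [u m + 2 * e m.+1]. *)
Lemma real_geometric_limit (u : nat -> R) k0 :
  (forall k, (k0 <= k)%N -> `|u k.+1 - u k| <= e k.+1) ->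
  exists l, forall k, (k0 <= k)%N -> `|u k - l| <= 2 * e k.+1.
Proof.
move=> hu.
have step k m : (k0 <= k)%N -> `|u (k + m)%N - u k| <= 2 * e k.+1 - 2 * e (k + m).+1.
  move=> hk; elim: m => [|m IH]; first by rewrite addn0 !subrr normr0.
  rewrite addnS; have := hu (k + m)%N (leq_trans hk (leq_addr _ _)).
  have := e_step (k + m).+1; have := e_gt0 (k + m).+1.
  have := ler_normD (u (k + m).+1 - u (k + m)%N) (u (k + m)%N - u k).
  rewrite addrA subrK; lra.
pose S := [set x | exists2 k, (k0 <= k)%N & x = u k - 2 * e k.+1].
have ub k : (k0 <= k)%N -> ubound S (u k + 2 * e k.+1).
  move=> hk _ [m hm ->]; have := e_gt0 k.+1; have := e_gt0 m.+1.
  have [km|/ltnW mk] := leqP k m.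
    have := step k (m - k)%N hk; rewrite subnKC // ler_distl; lra.
  have := step m (k - m)%N hm; rewrite subnKC // ler_distl; lra.
have S0 : S !=set0 by exists (u k0 - 2 * e k0.+1); exists k0.
exists (sup S) => k hk; rewrite distrC ler_distl; apply/andP; split.
  apply: ub_le_sup; last by exists k.
  by exists (u k + 2 * e k.+1); exact: ub.
by apply: ge_sup => //; exact: ub.
Qed.

(** The factor 4 is 2 for the real part plus 2 for the imaginary part; the slack [4 * e] of
    [invariant] matches it. *)
Lemma complex_geometric_limit (u : nat -> C) k0 :
  (forall k, (k0 <= k)%N -> normc (u k.+1 - u k) <= e k.+1) ->
  exists l, forall k, (k0 <= k)%N -> normc (u k - l) <= 4 * e k.+1.
Proof.
move=> hu.
have [|x hx] := @real_geometric_limit (fun k => complex.Re (u k)) k0.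
  move=> k hk; apply: le_trans (hu k hk); apply: le_trans (normc_geRe _).
  by case: (u k.+1) (u k) => ? ? [].
have [|y hy] := @real_geometric_limit (fun k => complex.Im (u k)) k0.
  move=> k hk; apply: le_trans (hu k hk); apply: le_trans (normc_geIm _).
  by case: (u k.+1) (u k) => ? ? [].
exists (x +i* y)%C => k hk; apply: le_trans (normc_leReIm _) _.
have := hx k hk; have := hy k hk; case: (u k) => a b /=; lra.
Qed.

(** Passage to the limit in an inequality, since [e (k0 + m)] is at most [e k0 / m.+1]. *)
Lemma geometric_vanish k0 (x y c : R) : 0 < c ->
  (forall k, (k0 <= k)%N -> x <= y + c * e k) -> x <= y.
Proof.
move=> c0 h; rewrite leNgt; apply/negP => yx.
have small m : e (k0 + m)%N * m.+1%:R <= e k0.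
  elim: m => [|m IH]; first by rewrite addn0 mulr1.
  apply: le_trans IH; rewrite addnS.
  have := e_step (k0 + m); have := e_gt0 (k0 + m); rewrite -[m.+2]addn2 -[m.+1]addn1 !natrD.
  have : 0 <= m%:R :> R by [].
  move: (m%:R) (e _) (e _) => M a b; nra.
pose m := Num.bound (c * e k0 / (x - y)).
have hm : c * e k0 / (x - y) < m%:R.
  by apply: archi_boundP; rewrite divr_ge0 ?mulr_ge0 ?ltW // subr_gt0.
have := h (k0 + m)%N (leq_addr _ _); have := small m.
move: hm; rewrite ltr_pdivrMr ?subr_gt0 // -natr1.
have := e_gt0 (k0 + m); have : 0 <= m%:R :> R by [].
move: (m%:R) (e _) (e _) => M a b; nra.
Qed.

End GeometricLimits.

(** * Growth of polynomials at infinity *)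

Section PolynomialGrowth.
Variable R : realType.
Local Notation C := (R[i]).

Lemma polynomial_unbounded (p : {poly C}) : (1 < size p)%N ->
  forall M : R, exists r : R, forall z, r <= normc z -> M <= normc p.[z].
Proof.
(* The induction needs a positive lower bound far out for every nonzero polynomial, constants
   included; one more Horner step turns it into linear growth. *)
suff bound : p != 0 -> exists d r : R, 0 < d /\ forall z, r <= normc z -> d <= normc p.[z] /\
    ((1 < size p)%N -> d * (normc z - r) <= normc p.[z]).
  move=> sp M; have [|d [r [d0 h]]] := bound.
    by rewrite -size_poly_gt0; exact: ltn_trans sp.
  exists (r + `|M| / d) => z hz; have [|_ /(_ sp)] := h z.
    by apply: le_trans hz; rewrite lerDl divr_ge0 // ltW.
  apply: le_trans; apply: le_trans (ler_norm M) _.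
  rewrite mulrC -ler_pdivrMr //; lra.
elim/poly_ind: p => [|p c IH]; first by rewrite eqxx.
have [-> |p0] := eqVneq p 0.
  rewrite mul0r add0r polyC_eq0 => c0.
  exists (normc c), 0; split; first exact: normc_gt0.
  by move=> z _; rewrite hornerC size_polyC c0; split.
move=> _; have [d [r [d0 h]]] := IH p0.
exists d, (Num.max r 0 + normc c / d + 1); split=> // z hz.
have nc : 0 <= normc c / d by rewrite divr_ge0 ?normc_ge0 // ltW.
have r0 : 0 <= Num.max r 0 by rewrite le_max lexx orbT.
have rz : r <= normc z.
  have : r <= Num.max r 0 by rewrite le_max lexx.
  lra.
have [h1 _] := h z rz.
have H : d * normc z - normc c <= normc (p * 'X + c%:P).[z].
  rewrite hornerMXaddC.
  have := normcD (p.[z] * z + c) (- c); rewrite addrK (@normcN R) normcM.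
  have : d * normc z <= normc p.[z] * normc z by rewrite ler_wpM2r // normc_ge0.
  lra.
have dc : d * (normc c / d) = normc c by rewrite mulrCA mulfV ?gt_eqF // mulr1.
split.
  apply: le_trans H.
  have : d * (Num.max r 0 + normc c / d + 1) <= d * normc z by rewrite ler_pM2l.
  have : 0 <= d * Num.max r 0 by rewrite mulr_ge0 // ltW.
  by rewrite !mulrDr dc mulr1; lra.
move=> _; apply: le_trans H; rewrite mulrBr lerD2l lerN2 !mulrDr dc mulr1.
have : 0 <= d * Num.max r 0 by rewrite mulr_ge0 // ltW.
lra.
Qed.

End PolynomialGrowth.

(** * The limit function and its orbits from the holes *)

Section LimitFunction.
Variable R : realType.
Local Notation C := (R[i]).
Variables (stay : nat -> nat) (p : nat -> {poly R}) (e v : nat -> R).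
Hypothesis stages : forall j, invariant j (p j) (e j) /\
  stage stay j (p j) (e j) (v j) (p j.+1) (e j.+1).
Local Notation climb := (climb stay).

Lemma tolerance_gt0 k : 0 < e k.
Proof. by have [[]] := stages k. Qed.
Lemma tolerance_step k : e k.+1 <= e k / 4.
Proof. by have [_ [/andP[]]] := stages k. Qed.
Lemma tolerance_le k : e k <= 5^-1 / 2 ^+ k.
Proof.
elim: k => [|k IH]; first by have [[_ h _ _] _] := stages 0%N; rewrite expr0 divr1.
apply: le_trans (tolerance_step k) _.
rewrite exprS invfM mulrCA; have := tolerance_gt0 k; lra.
Qed.
#[local] Hint Resolve tolerance_gt0 tolerance_step : core.

Lemma stage_close j z : normc z <= Rad R j ->
  normc (ev (p j.+1) z - ev (p j) z) <= e j.+1.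
Proof.
by move=> zr; have [_ [_ h _ _ _]] := stages j; rewrite -evB; apply: le_trans (ev_le _ zr) h.
Qed.

Lemma limit_exists : exists f : C -> C, forall j z, normc z <= Rad R j ->
  normc (ev (p j) z - f z) <= 4 * e j.+1.
Proof.
have /choice [f hf] : forall z : C, exists l : C, forall j, normc z <= Rad R j ->
    normc (ev (p j) z - l) <= 4 * e j.+1.
  move=> z; have [[k0 hk0]|none] := pselect (exists k, normc z <= Rad R k).
    pose P k := normc z <= Rad R k.
    (* Starting at the smallest disc containing [z] lets a single limit serve every admissible
       [j]. *)
    have [k1 hk1 k1min] := ex_minnP (ex_intro P k0 hk0).
    have [|l hl] := @complex_geometric_limit R e tolerance_gt0 tolerance_step
        (fun k => ev (p k) z) k1.
      move=> k hk; apply: stage_close; apply: le_trans hk1 _; exact: Rad_homo.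
    by exists l => j hj; apply: hl; exact: k1min.
  by exists 0 => j hj; exfalso; apply: none; exists j.
by exists f => j z; exact: hf.
Qed.

Variable f : C -> C.
Hypothesis f_close : forall j z, normc z <= Rad R j ->
  normc (ev (p j) z - f z) <= 4 * e j.+1.

Lemma Rad_unbounded (M : R) : exists k, M < Rad R k.
Proof.
have [k hk] := exp2_unbounded M; exists k; apply: le_lt_trans hk _.
apply: (@le_lt_trans _ _ (100 ^+ k)).
  by rewrite lerXn2r ?nnegrE ?ler_nat.
by rewrite /Rad ltr_pMl ?exprn_gt0 // ltr1n.
Qed.

Lemma cnorm_homo (r s : R) (q : {poly R}) : 0 <= r <= s -> cnorm r q <= cnorm s q.
Proof.
move=> /andP[r0 rs]; elim/poly_ind: q => [|q c IH]; first by rewrite !cnorm0.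
rewrite !cnorm_MXaddC lerD2l; apply: ler_pM => //; exact: cnorm_ge0.
Qed.

(** The derivatives of the [p k] at [z] converge to some [L], and their second-order remainders
    share one constant [B], so the remainder bound survives in the limit. *)
Lemma limit_entire : entire f.
Proof.
move=> z _; have [j hj] := Rad_unbounded (normc z + 1).
have zj : normc z + 1 <= Rad R j by exact: ltW.
have Rj0 : 0 <= Rad R j by apply: le_trans (Rad_ge _ j).
have close k : (j <= k)%N -> cnorm (Rad R j) (p k.+1 - p k) <= e k.+1.
  move=> jk; have [_ [_ h _ _ _]] := stages k; apply: le_trans h.
  by apply: cnorm_homo; rewrite Rj0 Rad_homo.
have one1 : normc 1 <= 1 :> R by rewrite normc1.
have [|||L hL] := @complex_geometric_limit R (fun k => 2 * e k) _ _ (fun k => ev (p k)^`() z) j.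
- by move=> k; rewrite mulr_gt0.
- by move=> k; have := tolerance_step k; lra.
- move=> k jk; rewrite -evB -derivB; set q := p k.+1 - p k.
  (* With [h = 1], the derivative of [q] is a first difference minus a Taylor remainder, each at
     most [e k.+1]; hence the sequence [2 * e]. *)
  have := ev_taylor_le Rj0 q ltr01 one1 zj.
  have := ev_diff_le Rj0 q ltr01 one1 zj.
  have := close k jk; rewrite -/q normc1 divr1 expr1n !mul1r mulr1.
  have := normcD (ev q (z + 1) - ev q z) (- (ev q (z + 1) - ev q z - ev q^`() z)).
  rewrite (@normcN R).
  have -> : ev q (z + 1) - ev q z - (ev q (z + 1) - ev q z - ev q^`() z) = ev q^`() z by ring.
  lra.
pose B := cnorm (Rad R j) (p j) + 1.
have B0 : 0 < B by rewrite ltr_pwDr // cnorm_ge0.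
(* The subtracted [2 * e k.+1] pays for the later corrections in the induction. *)
have hB k : (j <= k)%N -> cnorm (Rad R j) (p k) <= B - 2 * e k.+1.
  move=> /subnKC <-; elim: (k - j)%N => [|m IH].
    rewrite addn0 /B; have := tolerance_le j.+1.
    have : 1 <= 2 ^+ j.+1 :> R by rewrite exprn_ege1 // ler1n.
    have p2 : 0 < 2 ^+ j.+1 :> R by rewrite exprn_gt0.
    rewrite ler_pdivlMr //; have := tolerance_gt0 j.+1; nra.
  rewrite addnS; have := close (j + m)%N (leq_addr _ _).
  have := cnormD Rj0 (p (j + m).+1 - p (j + m)%N) (p (j + m)%N); rewrite subrK.
  have := tolerance_step (j + m).+1; have := tolerance_gt0 (j + m).+1; lra.
apply/derivable_normcP; exists L => eps eps0.
exists (Num.min 1 (eps / B)); first by rewrite lt_min ltr01 divr_gt0.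
move=> w; rewrite lt_min => /andP[w1 weps].
have key : normc (f w - f z - L * (w - z)) <= B * normc (w - z) ^+ 2.
  (* 16 is 4 for each of [f w] and [f z], plus 8 for the derivative. *)
  apply: (@geometric_vanish R e tolerance_gt0 tolerance_step j _ _ 16) => // k jk.
  have ej := tolerance_step k; have ek := tolerance_gt0 k; have ek1 := tolerance_gt0 k.+1.
  have Rjk : Rad R j <= Rad R k by exact: Rad_homo.
  have zR : normc z <= Rad R k by lra.
  have wR : normc w <= Rad R k.
    by have := normcD (w - z) z; rewrite subrK; lra.
  have := f_close zR; have := f_close wR; have := hL k jk.
  have := ev_taylor_le Rj0 (p k) ltr01 (ltW w1) zj.
  rewrite (_ : z + (w - z) = w); last by rewrite addrC subrK.
  rewrite divr1; have wz0 := normc_ge0 (w - z).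
  have := ler_wpM2l (exprn_ge0 2 wz0) (hB k jk).
  set T := ev (p k) w - ev (p k) z - _; set a := ev (p k) w - f w.
  set b := ev (p k) z - f z; set d := _ - L.
  have -> : f w - f z - L * (w - z) = T - a + b + d * (w - z) by rewrite /T /a /b /d; ring.
  have := normcD (T - a + b) (d * (w - z)); have := normcD (T - a) b; have := normcD T (- a).
  rewrite (@normcN R) normcM => h1 h2 h3 h4 h5 h6 h7 h8.
  have h9 : normc d * normc (w - z) <= normc d by rewrite ler_piMr ?normc_ge0 // ltW.
  have : 0 <= normc (w - z) ^+ 2 * (2 * e k.+1) by rewrite mulr_ge0 ?exprn_ge0 // mulr_ge0 // ltW.
  lra.
apply: le_trans key _; rewrite expr2 mulrA ler_wpM2r ?normc_ge0 //.
by rewrite mulrC -ler_pdivlMr // ltW.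
Qed.

Lemma limit_circle k z : normc z = Rad R k -> Rad R k.+1 <= normc (f z).
Proof.
move=> zk; have [[_ _ _ /(_ k (leqnn k) z zk) hk] _] := stages k.
have := @f_close k z; rewrite zk lexx => /(_ isT).
have := normcD (ev (p k) z - f z) (f z); rewrite subrK.
have := tolerance_step k; have := tolerance_gt0 k; lra.
Qed.

Definition hole j : R := cen R j.+1 + 10.

(** The error [e j.+1] of [p j.+1] on the hole, plus the distance [4 * e j.+2] to the limit, itself
    at most [e j.+1]. *)
Lemma hole_image j w : normc (w - (hole j)%:C%C) <= 1 ->
  normc (f w - (v j)%:C%C) <= 2 * e j.+1.
Proof.
move=> wh; have [_ [_ _ _ _ [_ /(_ w wh) hw]]] := stages j.
have wR : normc w <= Rad R j.+1.
  have := normcD (w - (hole j)%:C%C) (hole j)%:C%C; rewrite subrK normc_real.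
  have := cen_ge R j; have := Rad_cen R j.
  have : hole j = cen R j.+1 + 10 by [].
  by move=> E c1 c2; rewrite ger0_norm; lra.
have := f_close wR.
have := normcD (ev (p j.+1) w - (v j)%:C%C) (- (ev (p j.+1) w - f w)); rewrite (@normcN R).
have -> : ev (p j.+1) w - (v j)%:C%C - (ev (p j.+1) w - f w) = f w - (v j)%:C%C by ring.
have := tolerance_step j.+1; lra.
Qed.

Lemma block_close j w : normc (w - (hole j)%:C%C) <= 1 -> forall i, (i <= climb j)%N ->
  normc (iter i.+1 f w - (iter i (horner (p j)) (v j))%:C%C) <= 100^-1 / 2 ^+ j.
Proof.
move=> wh i iK; have [_ [_ _ _ [h _] _]] := stages j.
rewrite iterSr; apply: h => //.
  by move=> z zR; rewrite normcB_sym; exact: f_close.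
apply: le_trans (hole_image wh) _; have := tolerance_gt0 j.+1; lra.
Qed.

(** Slope 20 magnifies the shadowing error 1/100 to 1/5, and the approximation errors add at most
    another 1/5, all divided by [2 ^+ j]. The time is one step out of the hole, [climb j] steps of
    itinerary and one step into the next hole. *)
Lemma block_end j w : normc (w - (hole j)%:C%C) <= 1 ->
  normc (iter (climb j).+2 f w - (hole j.+1)%:C%C) <= 2^-1 / 2 ^+ j.
Proof.
move=> wh; have := block_close wh (leqnn _).
have [_ [_ _ _ [_ ->] [h _]]] := stages j.
rewrite [iter (climb j).+2 f w]iterS; set u := iter (climb j).+1 f w => hu.
have t0 : 0 < 2 ^+ j :> R by rewrite exprn_gt0.
have t1 : 1 / 2 ^+ j <= 1 :> R by rewrite ler_pdivrMr // mul1r exprn_ege1 // ler1n.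
have uz : normc (u - (cen R j.+1)%:C%C) <= 1.
  have := normcD (u - (cen R j.+1 + 2^-1)%:C%C) (2^-1)%:C%C.
  rewrite normc_real ger0_norm //.
  rewrite (_ : u - _ + _ = u - (cen R j.+1)%:C%C); last by rewrite rmorphD; ring.
  lra.
have uR : normc u <= Rad R j.+1.
  have := normcD (u - (cen R j.+1)%:C%C) (cen R j.+1)%:C%C; rewrite subrK normc_real.
  have := cen_ge R j; have := Rad_cen R j.
  by move=> c1 c2; rewrite ger0_norm; lra.
have := f_close uR; have := h u uz.
have -> : f u - (hole j.+1)%:C%C = (ev (p j.+1) u - aff j.+1 u) - (ev (p j.+1) u - f u)
    + 20 * (u - (cen R j.+1 + 2^-1)%:C%C).
  have k : 20 * (2^-1)%:C%C = 10 :> C.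
    by rewrite -!(rmorph_nat (real_complex R)) -rmorphM; congr (_%:C%C); lra.
  rewrite /aff /hole [(cen R j.+2 + 10)%:C%C]rmorphD [(cen R j.+1 + 2^-1)%:C%C]rmorphD.
  rewrite rmorph_nat -k; ring.
move=> h1 h2; apply: le_trans (normcD _ _) _; rewrite normcM normc_nat.
have := normcD (ev (p j.+1) u - aff j.+1 u) (- (ev (p j.+1) u - f u)); rewrite (@normcN R).
have := tolerance_step j.+1; have := tolerance_le j.+1; have := tolerance_gt0 j.+1.
rewrite exprS invfM; lra.
Qed.

(** The bound 2 at the hole centres, which tend to infinity, excludes nonconstant polynomials; the
    growth on the circles excludes constants. *)
Lemma limit_transcendental : transcendental_entire f.
Proof.
split; first exact: limit_entire.
move=> [q hq].
have v1 j : `|v j| <= 1.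
  by have [_ [_ _ /(_ 0%N (leq0n _)) + _ _]] := stages j; rewrite sub0n /= subr0.
have f2 j : normc (f (hole j)%:C%C) <= 2.
  have := @hole_image j (hole j)%:C%C; rewrite subrr normc0 => /(_ ler01).
  have := normcD (f (hole j)%:C%C - (v j)%:C%C) (v j)%:C%C; rewrite subrK normc_real.
  have := tolerance_le j.+1; have := v1 j.
  have t1 : 1 / 2 ^+ j.+1 <= 1 :> R.
    by rewrite ler_pdivrMr ?exprn_gt0 // mul1r exprn_ege1 // ler1n.
  lra.
have hole_Rad j : Rad R j <= hole j by have := cen_Rad R j; rewrite /hole; lra.
have [sq|sq] := ltnP 1 (size q).
  have [r hr] := polynomial_unbounded sq 3.
  have [j hj] := Rad_unbounded r.
  have := f2 j; rewrite hq => h; have := hr (hole j)%:C%C; rewrite normc_real.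
  have := hole_Rad j; have := ler_norm (hole j); lra.
have [j hj] := Rad_unbounded (normc q`_0).
have := @limit_circle j (Rad R j)%:C%C; rewrite normc_real ger0_norm; last first.
  by apply: le_trans (Rad_ge R j).
move=> /(_ erefl); rewrite hq (size1_polyC sq) hornerC.
have := Rad_ge R j; rewrite RadS; lra.
Qed.

End LimitFunction.

(** * Itinerary and density of the visits *)

Section Schedule.
Variable stay : nat -> nat.
Local Notation climb := (climb stay).

Fixpoint block_start j : nat := if j is j'.+1 then (block_start j' + (climb j').+2)%N else 0.
Fixpoint low_times j : nat := if j is j'.+1 then (low_times j' + (stay j').+1)%N else 0.

(* Block [j] starts in the [j]-th hole (at level [j.+1]), then spends
   [(stay j).+1] steps at level 0 and climbs through the levels 1, ..., [j.+1];
   [state n = (j, i)] means that time [n] is the [i]-th step of block [j]. *)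
Definition next (s : nat * nat) : nat * nat :=
  if (s.2 <= climb s.1)%N then (s.1, s.2.+1) else (s.1.+1, 0%N).
Definition state n := iter n next (0%N, 0%N).
Definition level n : nat :=
  let: (j, i) := state n in if i is i'.+1 then (i' - stay j)%N else j.+1.

Lemma state_start j : state (block_start j) = (j, 0%N) ->
  forall i, (i <= (climb j).+1)%N -> state (block_start j + i) = (j, i).
Proof.
move=> hj; elim=> [|i IH] hi; first by rewrite addn0.
by rewrite addnS /state iterS -/(state _) IH ?(ltnW hi) // /next /= -ltnS hi.
Qed.

Lemma state_block j i : (i <= (climb j).+1)%N -> state (block_start j + i) = (j, i).
Proof.
suff : state (block_start j) = (j, 0%N) by move=> h; exact: state_start.
elim: j => [//|j IH].
rewrite [block_start _]/= addnS /state iterS -/(state _) state_start //.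
by rewrite /next /= ltnn.
Qed.

Lemma block_decomposition n : exists j i, (i <= (climb j).+1)%N /\ n = (block_start j + i)%N.
Proof.
elim: n => [|n [j [i [hi ->]]]]; first by exists 0%N, 0%N.
have [ij|ij] := ltnP i (climb j).+1.
  by exists j, i.+1; rewrite addnS.
exists j.+1, 0%N; split=> //.
have -> : i = (climb j).+1 by apply/eqP; rewrite eqn_leq hi.
by rewrite addn0 /= !addnS.
Qed.

Lemma level_block j i : (i <= (climb j).+1)%N ->
  level (block_start j + i) = if i is i'.+1 then (i' - stay j)%N else j.+1.
Proof. by move=> hi; rewrite /level state_block. Qed.

Lemma level_step n : (level n.+1 <= (level n).+1)%N.
Proof.
have [j [i [hi ->]]] := block_decomposition n.
have [ij|ij] := ltnP i (climb j).+1.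
  rewrite -addnS !level_block //.
  by case: i {hi ij} => [|i] //; lia.
have -> : i = (climb j).+1 by apply/eqP; rewrite eqn_leq hi.
have -> : ((block_start j + (climb j).+1).+1 = block_start j.+1 + 0)%N by rewrite addn0 /= !addnS.
rewrite !level_block // /climb; lia.
Qed.

Lemma level_top j : exists2 n, (j <= level n)%N & level n.+1 = 0%N.
Proof.
exists (block_start j); first by rewrite -[block_start j]addn0 level_block.
by rewrite -addn1 level_block.
Qed.

Definition low_count k := (\sum_(n < k) (level n == 0%N))%N.

Lemma low_count_start j : low_count (block_start j) = low_times j ->
  forall i, (i <= (climb j).+1)%N ->
  low_count (block_start j + i).+1 = (low_times j + minn i (stay j).+1)%N.
Proof.
move=> hj; elim=> [|i IH] hi.
  rewrite addn0 /low_count big_ord_recr -/(low_count _) hj /=.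
  by rewrite -{1}[block_start j]addn0 level_block // min0n.
rewrite addnS /low_count big_ord_recr -/(low_count _) IH ?(ltnW hi) //=.
rewrite -addnS level_block //; lia.
Qed.

Lemma low_count_block j i : (i <= (climb j).+1)%N ->
  low_count (block_start j + i).+1 = (low_times j + minn i (stay j).+1)%N.
Proof.
suff : low_count (block_start j) = low_times j by move=> h; exact: low_count_start.
elim: j => [|j IH]; first by rewrite /low_count big_ord0.
by rewrite [block_start _]/= addnS low_count_start //= /climb; lia.
Qed.

Lemma block_start_homo : {homo block_start : m n / (m <= n)%N}.
Proof.
by apply: homo_leq => [//|? ? ? /leq_trans|j]; [exact|rewrite /= leq_addr].
Qed.

End Schedule.

(** * Choice of the waiting times *)

Section Density.
Variable R : realType.

(** Block [i] lasts at least [i + 3] steps, so starting times grow at least quadratically, which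
    beats a discrepancy linear in the block number. *)
Lemma block_start_ge stay j : (j * j + 5 * j <= 2 * block_start stay j)%N.
Proof. by elim: j => [//|j IH] /=; rewrite /climb; nia. Qed.

(** Block [j] has [(stay j).+1] low times and [j.+2] high ones. For [lambda < 1] the waiting time is
    [j.+2] times [lambda / (1 - lambda)], rounded down; for [lambda = 1] it is quadratic, so that
    high times become negligible. *)
Lemma schedule_exists (lambda : R) : 0 <= lambda <= 1 -> exists stay : nat -> nat,
  forall j i, (i <= (climb stay j).+1)%N -> (0 < block_start stay j + i)%N ->
  `|(low_times stay j + minn i (stay j).+1)%:R - lambda * (block_start stay j + i)%:R|
     * j.+1%:R <= 4 * (block_start stay j + i)%:R.
Proof.
move=> /andP[l0 l1].
have [l1'|l1'] := eqVneq lambda 1.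
  pose stay j := (j.+2 * j.+2)%N; exists stay => j i hi k0.
  rewrite l1' mul1r -normrN opprB.
  (* High times before block [q] number [q * (q + 3) / 2]; the next claim shows that starting times
     grow cubically. *)
  have E q : (2 * block_start stay q = 2 * low_times stay q + q * (q + 3))%N.
    by elim: q => [//|q IH] /=; rewrite /climb; move: IH (stay q) => + t; nia.
  have B q : (q.+1 * q.+1 * (q + 4) <= 4 * (block_start stay q).+1)%N.
    elim: q => [//|q IH]; rewrite [block_start _ _]/= /climb /stay.
    have D : (q.+2 * q.+2 * (q.+1 + 4) = q.+1 * q.+1 * (q + 4) + (3 * (q * q) + 15 * q + 16))%N.
      by lia.
    rewrite D; have D' : (q.+2 * q.+2 = q * q + 4 * q + 4)%N by lia.
    rewrite D'; move: IH; set x := (_ * (q + 4))%N; set y := (q * q)%N.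
    move: (block_start _ _) x y => b x y; lia.
  have low_le : (low_times stay j + minn i (stay j).+1 <= block_start stay j + i)%N.
    by have := E j; have := geq_minl i (stay j).+1; lia.
  rewrite ger0_norm ?subr_ge0 ?ler_nat // -natrB // -!natrM ler_nat.
  have := B j; have := E j; move: hi k0; rewrite /climb.
  move: (block_start _ _) (low_times _ _) (stay j) => b a t hi k0 hb hB.
  have : (2 * (b + i - (a + minn i t.+1)) <= j * (j + 3) + 2 * j.+1)%N by lia.
  move: (b + i - _)%N => x hx.
  have : (2 * x * j.+1 <= (j * (j + 3) + 2 * j.+1) * j.+1)%N by rewrite leq_mul2r hx orbT.
  lia.
have ll : 0 < 1 - lambda by rewrite subr_gt0 lt_neqAle l1' l1.
pose theta := lambda / (1 - lambda).
have th0 : 0 <= theta by rewrite divr_ge0 // ltW.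
pose stay j := Num.truncn (theta * j.+2%:R).
have hstay j : (1 - lambda) * (stay j)%:R <= lambda * j.+2%:R /\
    lambda * j.+2%:R <= (1 - lambda) * (stay j).+1%:R.
  have /andP[h1 h2] : (stay j)%:R <= theta * j.+2%:R < (stay j).+1%:R.
    by apply: truncn_itv; rewrite mulr_ge0.
  have E : lambda * j.+2%:R = (1 - lambda) * (theta * j.+2%:R).
    by rewrite mulrA [(1 - lambda) * _]mulrC divfK // gt_eqF.
  by rewrite E; split; rewrite ler_pM2l // ltW.
exists stay => j i hi k0.
(* Rounding down adds between 0 and [1 - lambda] to the discrepancy in each complete block. *)
have start q : 0 <= (1 - lambda) * (low_times stay q)%:R -
    lambda * ((block_start stay q)%:R - (low_times stay q)%:R) <= (1 - lambda) * q%:R.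
  elim: q => [|q IH]; first by rewrite /= subrr !mulr0 subrr lexx.
  have [h1 h2] := hstay q; move: IH h1 h2; rewrite /= /climb.
  rewrite -[q.+2]addn2 -[(_ + q.+1).+2]addn2 -[q.+1]addn1 -[(stay q).+1]addn1 !natrD.
  move: (low_times _ _)%:R (block_start _ _)%:R (stay q)%:R (q%:R) => A b s Q; lra.
(* Within a block the discrepancy rises along the low times, then falls during the climb, without
   becoming negative. *)
have key : 0 <= (low_times stay j + minn i (stay j).+1)%:R -
    lambda * (block_start stay j + i)%:R <= j.+2%:R.
  have [h1 h2] := hstay j; have := start j; move: h1 h2.
  have i0 : 0 <= i%:R :> R by [].
  have j0 : 0 <= j%:R :> R by [].
  have [im|im] := leqP i (stay j).+1.
    have : (i%:R : R) <= (stay j).+1%:R by rewrite ler_nat.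
    rewrite !natrD -[j.+2]addn2 -[(stay j).+1]addn1 !natrD.
    move: (low_times _ _)%:R (block_start _ _)%:R (stay j)%:R (j%:R) (i%:R) i0 j0 => A b s J I; nra.
  have : (i%:R : R) <= (stay j)%:R + j%:R + 2.
    by rewrite -!natrD ler_nat; move: hi; rewrite /climb; lia.
  have : (stay j)%:R + 1 <= (i%:R : R) by rewrite natr1 ler_nat ltnW.
  rewrite !natrD -[j.+2]addn2 -[(stay j).+1]addn1 !natrD.
  move: (low_times _ _)%:R (block_start _ _)%:R (stay j)%:R (j%:R) (i%:R) i0 j0 => A b s J I; nra.
move: key => /andP[key0 key1]; rewrite ger0_norm //.
apply: (@le_trans _ _ (j.+2%:R * j.+1%:R)); first by rewrite ler_wpM2r.
rewrite -!natrM ler_nat; have := block_start_ge stay j; nia.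
Qed.

End Density.

(** * The orbit of the first hole and the conclusion *)

Section Assembly.
Variable R : realType.
Local Notation C := (R[i]).
Variables (stay : nat -> nat) (p : nat -> {poly R}) (e v : nat -> R) (f : C -> C).
Hypothesis stages : forall j, invariant j (p j) (e j) /\
  stage stay j (p j) (e j) (v j) (p j.+1) (e j.+1).
Hypothesis f_close : forall j z, normc z <= Rad R j ->
  normc (ev (p j) z - f z) <= 4 * e j.+1.
Local Notation climb := (climb stay).

(** A real reference sequence shadowed by the whole first hole; after the hole entry, each block
    follows an orbit of [p j] rather than of [f]. *)
Definition centre (s : nat * nat) : R :=
  if s.2 is i.+1 then iter i (horner (p s.1)) (v s.1) else hole R s.1.

Lemma start_in_hole w j : normc (w - (hole R 0)%:C%C) <= 1 ->
  normc (iter (block_start stay j) f w - (hole R j)%:C%C) <= 1 /\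
  ((0 < j)%N -> normc (iter (block_start stay j) f w - (hole R j)%:C%C) <= 1 / 2 ^+ j).
Proof.
move=> hw; elim: j => [//|j [IH _]].
have := block_end stages f_close IH; rewrite -iterD [((climb j).+2 + _)%N]addnC => h.
have h' : 2^-1 / 2 ^+ j = 1 / 2 ^+ j.+1 :> R by rewrite exprS invfM mul1r.
rewrite h' in h; split=> //; apply: le_trans h _.
by rewrite ler_pdivrMr ?exprn_gt0 // mul1r exprn_ege1 // ler1n.
Qed.

Lemma orbit_close w j i : normc (w - (hole R 0)%:C%C) <= 1 -> (i <= (climb j).+1)%N ->
  normc (iter (block_start stay j + i) f w - (centre (j, i))%:C%C) <= 1 / 2 ^+ j.
Proof.
move=> hw; have [h1 h2] := start_in_hole j hw; case: i => [_|i hi].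
  rewrite addn0 /centre /=; case: j h1 h2 => [h1 _|j _ ->//].
  by rewrite expr0 divr1.
rewrite addnC iterD /centre /=.
apply: le_trans (block_close stages f_close h1 hi) _.
have : 0 < (2 ^+ j)^-1 :> R by rewrite invr_gt0 exprn_gt0.
lra.
Qed.

(** All points of the first hole shadow the same centres, so in block [j] their images are within
    [2 / 2 ^+ j] of each other; no derivative is estimated. *)
Lemma orbit_contracts (eps : R) : 0 < eps -> exists N, forall n, (N <= n)%N ->
  forall w, normc (w - (hole R 0)%:C%C) < 1 ->
  normc (iter n f w - iter n f (hole R 0)%:C%C) < eps.
Proof.
move=> eps0; have [m hm] := exp2_unbounded (2 / eps).
exists (block_start stay m.+1) => n mn w hw.
have [j [i [hi nE]]] := block_decomposition stay n.
have mj : (m < j)%N.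
  rewrite ltnNge; apply/negP => jm.
  have := block_start_homo stay (jm : (j < m.+1)%N); move: mn; rewrite nE /=.
  lia.
rewrite nE.
have c1 := orbit_close (ltW hw) hi.
have c0 : normc ((hole R 0)%:C%C - (hole R 0)%:C%C : C) <= 1 by rewrite subrr normc0.
have {}c0 := orbit_close c0 hi.
set c := (centre _)%:C%C in c1 c0; set a := iter _ _ w in c1 *; set b := iter _ _ _ in c0 *.
have -> : a - b = (a - c) - (b - c) by ring.
apply: le_lt_trans (normcD _ _) _; rewrite (@normcN R).
have P : 2 / eps < 2 ^+ j by apply: le_lt_trans hm _; rewrite ltr_eXn2l // ltr1n.
have : 1 / 2 ^+ j < eps / 2.
  rewrite ltr_pdivrMr ?exprn_gt0 //; move: P; rewrite ltr_pdivrMr //; lra.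
lra.
Qed.

Lemma centre_low j i : (i <= climb j)%N -> `|centre (j, i.+1) - cen R (i - stay j)| <= 1.
Proof. by have [_ [_ _ h _ _]] := stages j; exact: h. Qed.

Lemma orbit_upper n : normc (iter n f (hole R 0)%:C%C) < Rad R (level stay n).
Proof.
have [j [i [hi ->]]] := block_decomposition stay n.
rewrite level_block //.
have := @orbit_close (hole R 0)%:C%C j i; rewrite subrr normc0 => /(_ ler01 hi).
have t1 : 1 / 2 ^+ j <= 1 :> R by rewrite ler_pdivrMr ?exprn_gt0 // mul1r exprn_ege1 // ler1n.
move: (iter _ _ _) => u hu.
have := normcD (u - (centre (j, i))%:C%C) (centre (j, i))%:C%C; rewrite subrK normc_real.
case: i hi hu => [|i] hi hu.
  move: hu; have -> : centre (j, 0%N) = cen R j.+1 + 10 by [].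
  by rewrite Rad_cen; have c1 := cen_ge R j; move=> hu; rewrite ger0_norm; lra.
move=> h; have := centre_low hi; move: hu h; move: (centre _) => c hu h hc.
have c0 := cen_ge0 R (i - stay j); have c2 := cen_le R (i - stay j).
have := ler_normD (c - cen R (i - stay j)) (cen R (i - stay j)).
rewrite subrK (ger0_norm c0); lra.
Qed.

Lemma orbit_lower n k : level stay n = k.+1 -> Rad R k <= normc (iter n f (hole R 0)%:C%C).
Proof.
have [j [i [hi ->]]] := block_decomposition stay n.
rewrite level_block //.
have := @orbit_close (hole R 0)%:C%C j i; rewrite subrr normc0 => /(_ ler01 hi).
have t1 : 1 / 2 ^+ j <= 1 :> R by rewrite ler_pdivrMr ?exprn_gt0 // mul1r exprn_ege1 // ler1n.
move: (iter _ _ _) => u hu; have := cen_Rad R k.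
have := normcD (u - (centre (j, i))%:C%C) (- u); rewrite addrAC subrr add0r !(@normcN R) normc_real.
case: i hi hu => [|i] hi hu.
  move: hu; have -> : centre (j, 0%N) = cen R j.+1 + 10 by [].
  by move=> hu h c1 [jk]; move: hu h t1; rewrite jk; have := ler_norm (cen R k.+1 + 10); lra.
move=> h c1 E; have := centre_low hi; rewrite E; move: hu h; move: (centre _) => c hu h.
rewrite ler_distl; have := ler_norm c; lra.
Qed.

End Assembly.

Theorem corollary1p2 (R : realType) (lambda : R) (hlambda : 0 <= lambda <= 1) :
  exists (f : R[i] -> R[i]) (U D : set R[i]),
    [/\ transcendental_entire f,
        wandering_domain f U,
        domain D,
        bounded_set D &
        (fun k : nat => (visits f U D k)%:R / k%:R : R) @ \oo --> lambda].
Proof.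
have [stay hstay] := schedule_exists hlambda.
have [p [e [v stages]]] := stages_exist R stay.
have [f f_close] := limit_exists stages.
pose a : R[i] := (hole R 0)%:C%C.
have fE := limit_entire stages f_close.
have visit := component_visit fE ltr01 (orbit_contracts stages f_close) (@Rad_homo R)
  (@Rad_unbounded R) (limit_circle stages f_close) (orbit_upper stages f_close)
  (orbit_lower stages f_close) (level_step stay) (level_top stay).
have Rad0 : 0 < Rad R 0 by apply: lt_le_trans (Rad_ge R 0).
exists f, (connected_component (Fatou f) a), [set z | normc z < Rad R 0]; split.
- exact (limit_transcendental stages f_close).
- exact (component_wandering fE ltr01 (orbit_contracts stages f_close) (@Rad_homo R)
    (@Rad_unbounded R) (orbit_upper stages f_close) (orbit_lower stages f_close)
    (level_step stay) (level_top stay)).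
- exact: disc_domain.
- exact: disc_bounded.
(* The shift to [k.+1] arises because [low_count] counts times strictly below its argument. *)
have visitsE k : visits f (connected_component (Fatou f) a) [set z | normc z < Rad R 0] k =
    low_count stay k.+1.
  rewrite /visits -sum1_card big_mkcond /=; apply: eq_bigr => n _.
  suff -> : (n \in [set n : 'I_k.+1 | (0 < n)%N &&
      `[< iter n f @` connected_component (Fatou f) a `<=` [set z | normc z < Rad R 0] >]])
      = (level stay n == 0%N) by case: (_ == _).
  apply/idP/idP; rewrite in_setE /=.
    by move=> /andP[_ /asboolP /visit ->].
  move=> /eqP ln; apply/andP; split; last exact/asboolP/visit.
  (* Time 0 is spent in the first hole, at level 1, so it is not a low time. *)
  by rewrite lt0n; apply/eqP => n0; move: ln; rewrite n0.
apply/cvgrPdist_le => eps eps0.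
(* In block [j] the frequency differs from [lambda] by at most [4 / j.+1], so blocks from [2 ^ m] on
   suffice. *)
have [m hm] := exp2_unbounded (4 / eps).
exists (block_start stay (2 ^ m)).+1 => // k /= hk.
have [j [i [hi kE]]] := block_decomposition stay k.
have mj : (2 ^ m <= j)%N.
  rewrite leqNgt; apply/negP => jm.
  have := block_start_homo stay jm; move: hk; rewrite kE /=; lia.
have k0 : (0 < block_start stay j + i)%N by rewrite -kE; exact: leq_trans hk.
have := hstay j i hi k0; rewrite visitsE -(low_count_block hi) -kE => H.
have kp : 0 < k%:R :> R by rewrite ltr0n kE.
have -> : lambda - (low_count stay k.+1)%:R / k%:R =
   - (((low_count stay k.+1)%:R - lambda * k%:R) / k%:R) by field; rewrite gt_eqF.
rewrite normrN normrM normfV (gtr0_norm kp) ler_pdivrMr //.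
have j1 : 4 / eps <= j.+1%:R.
  apply: le_trans hm _; rewrite -natrX ler_nat; exact: leq_trans (leqnSn j).
move: j1; rewrite ler_pdivrMr // => j1.
have j0 : 0 < j.+1%:R :> R by [].
rewrite -(ler_pM2r j0); apply: le_trans H _.
have := ler_wpM2r (ltW kp) j1; lra.
Qed.
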